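(* Let $p\in[1,\infty)\setminus\{2\}$, let $m,n\in\mathbb{N}$, and let $k_1,\dots,k_m,\ell_1,\dots,\ell_n\in\mathbb{N}_{\geq2}$. If there exists a unital contractive homomorphism $$\mathcal{O}^p_{k_1}\otimes_p\cdots\otimes_p\mathcal{O}^p_{k_m}\to\mathcal{O}^p_{\ell_1}\otimes_p\cdots\otimes_p\mathcal{O}^p_{\ell_n},$$ then $m\leq n$.
   Context: For $k\in\mathbb{N}_{\ge2}$, let $S_0,T_0,\dots,S_{k-1},T_{k-1}\in\mathcal{B}(\ell^p(\mathbb{N}_0))$ be defined on the canonical basis $(\delta_r)_{r\in\mathbb{N}_0}$ by $S_j(\delta_r)=\delta_{kr+j}$, and $T_j(\delta_r)=\delta_l$ if $r=kl+j$, $T_j(\delta_r)=0$ otherwise. The $L^p$-Cuntz algebra $\mathcal{O}^p_k\subseteq\mathcal{B}(\ell^p(\mathbb{N}_0))$ is the Banach algebra generated by $S_0,T_0,\dots,S_{k-1},T_{k-1}$. For $L^p$-operator algebras $A\subseteq\mathcal{B}(L^p(\mu))$ and $B\subseteq\mathcal{B}(L^p(\mu'))$ (isometrically and nondegenerately represented), the spatial tensor product $A\otimes_pB$ is the completion of the algebraic tensor product $A\odot B$ in the norm inherited from $\mathcal{B}(L^p(\mu\times\mu'))$, where $a\otimes b$ acts by $(a\otimes b)(\xi\otimes\xi')=a(\xi)\otimes b(\xi')$. Here the defining representations are used, so $\mathcal{O}^p_{k_1}\otimes_p\cdots\otimes_p\mathcal{O}^p_{k_m}$ is the closed linear span of the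 elementary tensors $a_1\otimes\cdots\otimes a_m$, $a_i\in\mathcal{O}^p_{k_i}$, in $\mathcal{B}(\ell^p(\mathbb{N}_0^m))$. *)

(* Defs.v *)
From HB Require Import structures.
From mathcomp Require Import all_boot all_order all_algebra finmap.
From mathcomp Require Import complex.
From mathcomp Require Import all_classical all_reals all_analysis.
From mathcomp Require Import ring lra.

Set Implicit Arguments.
Unset Strict Implicit.
Unset Printing Implicit Defensive.

Import Order.TTheory GRing.Theory Num.Theory.
Import numFieldNormedType.Exports.
Import Normc.

Local Open Scope classical_set_scope.
Local Open Scope ring_scope.
Local Open Scope complex_scope.

HB.instance Definition _ (T : finType) (P : pointedType) :=
  isPointed.Build {ffun T -> P} [ffun=> point].

Section lp_functions.
Variables (R : realType) (p : R) (X : choiceType).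
Implicit Types (x y : X -> R[i]) (F : {fset X}).

Definition lp_sum x : \bar R := \esum_(i in [set: X]) (normc (x i) `^ p)%:E.

Definition lp_pred : {pred X -> R[i]} := fun x => `[< (lp_sum x < +oo)%E >].

Definition lp_norm x : R := fine (lp_sum x) `^ p^-1.

Lemma normc_ge0 (z : R[i]) : 0 <= normc z.
Proof. by case: z => a b; exact: sqrtr_ge0. Qed.

Lemma lp_sum_ge0 x : (0 <= lp_sum x)%E.
Proof. by apply: esum_ge0 => i _; rewrite lee_fin powR_ge0. Qed.

Lemma lp_norm_ge0 x : 0 <= lp_norm x.
Proof. exact: powR_ge0. Qed.

Hypothesis p1 : 1 <= p.

Let p0 : p != 0. Proof. by rewrite gt_eqF// (lt_le_trans _ p1). Qed.

Lemma lp_fin_sum_le x F : x \in lp_pred ->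
  \sum_(i <- F) normc (x i) `^ p <= lp_norm x `^ p.
Proof.
move=> /asboolP xfin; rewrite /lp_norm -powRrM mulVf// powRr1; last first.
  by rewrite fine_ge0// lp_sum_ge0.
rewrite -lee_fin fineK; last by rewrite ge0_fin_numE// lp_sum_ge0.
apply: esum_ge; exists [set` F]; first by split.
by rewrite fsbig_finite//= set_fsetK sumEFin.
Qed.

Lemma lp_norm_bound x c : 0 <= c ->
  (forall F, \sum_(i <- F) normc (x i) `^ p <= c `^ p) ->
  x \in lp_pred /\ lp_norm x <= c.
Proof.
move=> c0 xF; have le_s : (lp_sum x <= (c `^ p)%:E)%E.
  apply: ge_ereal_sup => _ [A [Afin _] <-].
  by rewrite fsbig_finite//= sumEFin lee_fin.
have xfin : (lp_sum x < +oo)%E by rewrite (le_lt_trans le_s)// ltry.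
split; first exact/asboolP.
rewrite /lp_norm -[leRHS](powRr1 c0) -(mulfV p0) powRrM.
rewrite ge0_ler_powR ?nnegrE ?powR_ge0 ?fine_ge0 ?lp_sum_ge0//.
  by rewrite invr_ge0 (le_trans _ p1).
by rewrite -lee_fin fineK// ge0_fin_numE// lp_sum_ge0.
Qed.

Lemma minkowski_fin (s : seq X) (a b : X -> R) (A B : R) :
  (forall i, 0 <= a i) -> (forall i, 0 <= b i) -> 0 <= A -> 0 <= B ->
  \sum_(i <- s) a i `^ p <= A `^ p -> \sum_(i <- s) b i `^ p <= B `^ p ->
  \sum_(i <- s) (a i + b i) `^ p <= (A + B) `^ p.
Proof.
have sum0 (f : X -> R) : (forall i, 0 <= f i) ->
    \sum_(i <- s) f i `^ p <= 0 `^ p -> forall i, i \in s -> f i = 0.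
  move=> f0; rewrite powR0// => le0 i is_.
  have /eqP : \sum_(i <- s) f i `^ p = 0.
    by apply/eqP; rewrite eq_le le0 sumr_ge0// => j _; exact: powR_ge0.
  rewrite psumr_eq0; last by move=> j _; exact: powR_ge0.
  by move=> /allP /(_ _ is_) /= /eqP /powR_eq0_eq0.
have pge0 : 0 <= p by rewrite (le_trans _ p1).
move=> a0 b0 A0 B0 sa sb.
have [Ae|An0] := eqVneq A 0.
  rewrite {}Ae add0r in sa *; apply: le_trans sb; rewrite le_eqVlt; apply/orP.
  by left; apply/eqP/eq_big_seq => i /(sum0 _ a0 sa) ->; rewrite add0r.
have [Be|Bn0] := eqVneq B 0.
  rewrite {}Be addr0 in sb *; apply: le_trans sa; rewrite le_eqVlt; apply/orP.
  by left; apply/eqP/eq_big_seq => i /(sum0 _ b0 sb) ->; rewrite addr0.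
have Apos : 0 < A by rewrite lt_def An0.
have Bpos : 0 < B by rewrite lt_def Bn0.
have ABpos : 0 < A + B by rewrite addr_gt0.
set t := A / (A + B).
have t01 : 0 <= t <= 1.
  by rewrite divr_ge0 ?(ltW ABpos)//= ler_pdivrMr// mul1r lerDl.
have t'E : 1 - t = B / (A + B).
  by rewrite /t; field; rewrite gt_eqF.
have step i : (a i + b i) `^ p <=
    (A + B) `^ p * (t * (a i / A) `^ p + (1 - t) * (b i / B) `^ p).
  have -> : a i + b i = (A + B) * (t * (a i / A) + (1 - t) * (b i / B)).
    by rewrite t'E /t; field; rewrite ?An0 ?Bn0 ?gt_eqF.
  case/andP: t01 => t0 t1.
  have cge0 : 0 <= t * (a i / A) + (1 - t) * (b i / B).
    by apply: addr_ge0; apply: mulr_ge0 => //; rewrite ?subr_ge0 ?divr_ge0.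
  rewrite (powRM _ (ltW ABpos) cge0).
  rewrite ler_wpM2l ?powR_ge0//.
  have := convex_powR p1 (Itv01 t0 t1) (x := a i / A) (y := b i / B).
  rewrite !convRE/=; apply.
  - by rewrite inE/= in_itv/= andbT divr_ge0.
  - by rewrite inE/= in_itv/= andbT divr_ge0.
apply: (@le_trans _ _ (\sum_(i <- s)
    (A + B) `^ p * (t * (a i / A) `^ p + (1 - t) * (b i / B) `^ p))).
  by apply: ler_sum => i _.
rewrite -mulr_sumr -[leRHS]mulr1 ler_wpM2l ?powR_ge0//.
have sc (f : X -> R) (M : R) : 0 < M -> (forall i, 0 <= f i) ->
    \sum_(i <- s) f i `^ p <= M `^ p -> \sum_(i <- s) (f i / M) `^ p <= 1.
  move=> M0 f0 fM; rewrite (eq_bigr (fun i => f i `^ p / M `^ p)); last first.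
    move=> i _; have -> : f i `^ p = (f i / M) `^ p * M `^ p.
      by rewrite -powRM ?divr_ge0 ?(ltW M0)// divfK ?gt_eqF.
    by rewrite mulfK// gt_eqF// powR_gt0.
  by rewrite -mulr_suml ler_pdivrMr ?powR_gt0// mul1r.
rewrite big_split/= -!mulr_sumr.
case/andP: t01 => t0 t1.
apply: (@le_trans _ _ (t * 1 + (1 - t) * 1)); last by rewrite !mulr1 subrKC.
by rewrite lerD// ler_wpM2l ?subr_ge0 ?sc.
Qed.

Lemma lp_norm_add x y : x \in lp_pred -> y \in lp_pred ->
  (x + y) \in lp_pred /\ lp_norm (x + y) <= lp_norm x + lp_norm y.
Proof.
move=> xp yp; apply: lp_norm_bound => [|F]; first by rewrite addr_ge0 ?lp_norm_ge0.
apply: le_trans (_ : \sum_(i <- F) (normc (x i) + normc (y i)) `^ p <= _).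
  apply: ler_sum => i _; rewrite ge0_ler_powR ?nnegrE ?normc_ge0//.
  - by rewrite (le_trans _ p1).
  - by rewrite addr_ge0 ?normc_ge0.
  - exact: le_normcD.
by apply: minkowski_fin => [i|i| | | |]; rewrite ?normc_ge0 ?lp_norm_ge0//;
  exact: lp_fin_sum_le.
Qed.

Lemma lp_normZ_le (c : R[i]) x : x \in lp_pred ->
  (c *: x) \in lp_pred /\ lp_norm (c *: x) <= normc c * lp_norm x.
Proof.
move=> xp; apply: lp_norm_bound => [|F]; first by rewrite mulr_ge0 ?lp_norm_ge0 ?normc_ge0.
rewrite powRM ?lp_norm_ge0 ?normc_ge0//.
rewrite (eq_bigr (fun i => normc c `^ p * normc (x i) `^ p)); last first.
  by move=> i _; rewrite -powRM ?normc_ge0// -normcM.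
by rewrite -mulr_sumr ler_wpM2l ?powR_ge0// lp_fin_sum_le.
Qed.

Lemma lp_pred0 : 0 \in lp_pred.
Proof.
suff [] : (0 : X -> R[i]) \in lp_pred /\ lp_norm (0 : X -> R[i]) <= 0 by [].
apply: lp_norm_bound => // F; rewrite big1// => i _.
by rewrite normc0 powR0.
Qed.

Lemma lp_subsemimod_closed : subsemimod_closed lp_pred.
Proof.
split; last by move=> c x xp; case: (lp_normZ_le c xp).
by split; [exact: lp_pred0 | move=> x y xp yp; case: (lp_norm_add xp yp)].
Qed.

End lp_functions.
Arguments lp_pred {R} p X _ : simpl never.

(* p1 is part of the type so that the normed structure below is canonical *)
Record lpspace (R : realType) (p : R) (p1 : 1 <= p) (X : choiceType) :=
  LpSpace { lp_val :> X -> R[i] ; lp_valP : lp_val \in lp_pred p X }.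

Section lpspace.
Variables (R : realType) (p : R) (p1 : 1 <= p) (X : choiceType).
Local Notation V := (lpspace p1 X).

HB.instance Definition _ := [isSub for @lp_val R p p1 X].
HB.instance Definition _ := [Choice of V by <:].
HB.instance Definition _ := GRing.SubChoice_isSubLmodule.Build
  R[i] (X -> R[i]) (lp_pred p X) V (lp_subsemimod_closed X p1).

Lemma lpspace_ext (x y : V) : x =1 y -> x = y.
Proof. by move=> xy; apply/val_inj/funext. Qed.

Lemma lp_valD (x y : V) i : (x + y) i = x i + y i. Proof. by []. Qed.
Lemma lp_valZ c (x : V) i : (c *: x) i = c * x i. Proof. by []. Qed.

Lemma normcE_complex (z : R[i]) : `|z| = (normc z)%:C. Proof. by []. Qed.

Let norm (x : V) : R[i] := (lp_norm p x)%:C.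

Let norm_add x y : norm (x + y) <= norm x + norm y.
Proof.
rewrite /norm -rmorphD/= lecR.
by case: (lp_norm_add p1 (lp_valP x) (lp_valP y)).
Qed.

Let normZ c x : norm (c *: x) = `|c| * norm x.
Proof.
rewrite normcE_complex /norm -rmorphM/=; congr (_%:C).
have le_n (d : R[i]) (y : V) : lp_norm p (d *: y) <= normc d * lp_norm p y.
  by case: (lp_normZ_le p1 d (lp_valP y)).
apply/eqP; rewrite eq_le le_n/=.
have [->|c0] := eqVneq c 0; first by rewrite normc0 mul0r lp_norm_ge0.
have nc0 : 0 < normc c.
  by rewrite lt_def normc_ge0 andbT; apply: contra_neq c0 => /eq0_normc.
have := le_n c^-1 (c *: x); rewrite scalerA mulVf// scale1r normcV.
by rewrite (ler_pdivlMl _ _ nc0).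
Qed.

Let norm_eq0 x : norm x = 0 -> x = 0.
Proof.
move=> [nx0]; apply: lpspace_ext => i; apply: eq0_normc.
have := lp_fin_sum_le p1 [fset i]%fset (lp_valP x).
rewrite big_seq_fset1 nx0 powR0; last by rewrite gt_eqF// (lt_le_trans _ p1).
move=> le0; apply/eqP; move/eqP: (powR_ge0 (normc (x i)) p).
by have/eqP/powR_eq0_eq0-> : normc (x i) `^ p == 0
  by rewrite eq_le le0 powR_ge0.
Qed.

HB.instance Definition _ :=
  Lmodule_isNormed.Build R[i] V norm_add normZ norm_eq0.

Lemma lpnormE (x : V) : `|x| = (lp_norm p x)%:C. Proof. by []. Qed.

End lpspace.

Section bounded_operators.
Variables (R : realType) (V : normedModType R[i]).

Definition bop_pred : {pred V -> V} :=
  fun f => `[< linear f /\ continuous f >].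

Lemma bop_subsemimod_closed : subsemimod_closed bop_pred.
Proof.
split; last first.
  move=> c f /asboolP[lf cf]; apply/asboolP; split.
    move=> a x y; rewrite -[LHS]/(c *: f _) lf scalerDr !scalerA mulrC.
    by rewrite -scalerA.
  by move=> x; apply: cvgZr; exact: cf.
split.
  apply/asboolP; split=> [a x y|x]; last exact: cvg_cst.
  by rewrite -[LHS]/(0 : V) -[0 x]/(0 : V) -[0 y]/(0 : V) scaler0 addr0.
move=> f g /asboolP[lf cf] /asboolP[lg cg]; apply/asboolP; split.
  move=> a x y; rewrite -[LHS]/(f _ + g _) lf lg.
  by rewrite -[(f + g) x]/(f x + g x) scalerDr addrACA.
by move=> x; apply: cvgD; [exact: cf|exact: cg].
Qed.

Record bop := Bop { bop_val :> V -> V ; bop_valP : bop_val \in bop_pred }.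

HB.instance Definition _ := [isSub for bop_val].
HB.instance Definition _ := [Choice of bop by <:].
HB.instance Definition _ := GRing.SubChoice_isSubLmodule.Build
  R[i] (V -> V) bop_pred bop bop_subsemimod_closed.

Implicit Types (f g h : bop) (x y : V).

Lemma bop_linear f : linear f.
Proof. by case/asboolP: (bop_valP f). Qed.

HB.instance Definition _ f := GRing.isLinear.Build _ _ _ _ f (bop_linear f).

Lemma bop_continuous f : continuous f.
Proof. by case/asboolP: (bop_valP f). Qed.

Lemma bop_ext f g : f =1 g -> f = g.
Proof. by move=> fg; apply/val_inj/funext. Qed.

Lemma bop_addE f g x : (f + g) x = f x + g x. Proof. by []. Qed.
Lemma bop_scaleE (c : R[i]) f x : (c *: f) x = c *: f x. Proof. by []. Qed.

Lemma bop_id_subproof : (id : V -> V) \in bop_pred.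
Proof. by apply/asboolP; split=> // x; exact: cvg_id. Qed.

Lemma bop_comp_subproof f g : (f \o g) \in bop_pred.
Proof.
apply/asboolP; split=> [a x y|x]; first by rewrite /= !linearP.
by apply: continuous_comp; exact: bop_continuous.
Qed.

Definition bop_one := Bop bop_id_subproof.
Definition bop_mul f g := Bop (bop_comp_subproof f g).

Fact bop_mulA : associative bop_mul. Proof. by move=> f g h; exact: bop_ext. Qed.
Fact bop_mul1l : left_id bop_one bop_mul. Proof. by move=> f; exact: bop_ext. Qed.
Fact bop_mul1r : right_id bop_one bop_mul. Proof. by move=> f; exact: bop_ext. Qed.
Fact bop_mulDl : left_distributive bop_mul +%R.
Proof. by move=> f g h; exact: bop_ext. Qed.
Fact bop_mulDr : right_distributive bop_mul +%R.
Proof. by move=> f g h; apply: bop_ext => x /=; rewrite linearD. Qed.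

HB.instance Definition _ := GRing.Zmodule_isPzRing.Build bop
  bop_mulA bop_mul1l bop_mul1r bop_mulDl bop_mulDr.

Lemma bop_oneE x : (1 : bop) x = x. Proof. by []. Qed.
Lemma bop_mulE f g x : (f * g) x = f (g x). Proof. by []. Qed.

(* norms on V take values in R[i], hence the real part *)
Definition opnorm f : R := sup [set complex.Re `|f x| | x in [set x : V | `|x| <= 1]].

Lemma Re_ge0K (z : R[i]) : 0 <= z -> (complex.Re z)%:C = z.
Proof. by move=> /ger0_real/RRe_real. Qed.

Lemma Re_normK x : (complex.Re `|x|)%:C = `|x|.
Proof. exact: Re_ge0K. Qed.

Lemma opnorm_has_sup f :
  has_sup [set complex.Re `|f x| | x in [set x : V | `|x| <= 1]].
Proof.
split; first by exists (complex.Re `|f 0|); exists 0 => //=; rewrite normr0.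
have /linear_boundedP : bounded_near f (nbhs (0 : V)).
  by apply/linear_bounded_continuous; exact: bop_continuous.
move=> /pinfty_ex_gt0[M M0 fM]; exists (complex.Re M) => _ [x /= x1 <-].
rewrite -lecR Re_normK (Re_ge0K (ltW M0)) (le_trans (fM x))//.
by rewrite -[leRHS]mulr1 ler_wpM2l// ltW.
Qed.

Lemma opnorm_ge0 f : 0 <= opnorm f.
Proof.
apply: ub_le_sup; first by case: (opnorm_has_sup f).
by exists 0 => /=; rewrite ?linear0 normr0.
Qed.

Lemma opnormP f x : `|f x| <= (opnorm f)%:C * `|x|.
Proof.
have [->|x0] := eqVneq x 0; first by rewrite linear0 !normr0 mulr0.
have nx0 : 0 < `|x| by rewrite normr_gt0.
rewrite -ler_pdivrMr//.
have -> : `|f x| / `|x| = `|f (`|x|^-1 *: x)|.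
  by rewrite linearZ normrZ normfV normr_id mulrC.
rewrite -Re_normK lecR; apply: ub_le_sup; first by case: (opnorm_has_sup f).
by exists (`|x|^-1 *: x) => //=; rewrite normrZ normfV normr_id mulVf ?gt_eqF.
Qed.

Lemma opnorm_le f (c : R) :
  (forall x, `|f x| <= c%:C * `|x|) -> 0 <= c -> opnorm f <= c.
Proof.
move=> fc c0; apply: ge_sup; first by case: (opnorm_has_sup f).
move=> _ [x /= x1 <-]; rewrite -lecR Re_normK (le_trans (fc x))//.
by rewrite -[leRHS]mulr1 ler_wpM2l// ler0c.
Qed.

Let norm f : R[i] := (opnorm f)%:C.

Let norm_add f g : norm (f + g) <= norm f + norm g.
Proof.
rewrite /norm -rmorphD/= lecR; apply: opnorm_le => [x|]; last first.
  by rewrite addr_ge0 ?opnorm_ge0.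
by rewrite (le_trans (ler_normD _ _))// rmorphD mulrDl lerD ?opnormP.
Qed.

Let normZ (c : R[i]) f : norm (c *: f) = `|c| * norm f.
Proof.
have le_n (d : R[i]) g : norm (d *: g) <= `|d| * norm g.
  rewrite normcE_complex /norm -rmorphM/= lecR; apply: opnorm_le => [x|].
    by rewrite normrZ rmorphM/= -mulrA ler_wpM2l// opnormP.
  by rewrite mulr_ge0 ?opnorm_ge0 ?normc_ge0.
apply/eqP; rewrite eq_le le_n/=.
have [->|c0] := eqVneq c 0.
  by rewrite normr0 mul0r ler0c opnorm_ge0.
rewrite mulrC -ler_pdivlMr ?normr_gt0// mulrC -normfV.
by apply: le_trans (le_n _ _); rewrite scalerA mulVf// scale1r.
Qed.

Let norm_eq0 f : norm f = 0 -> f = 0.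
Proof.
move=> nf0; apply: bop_ext => x; have := opnormP f x.
by rewrite -/(norm f) nf0 mul0r normr_le0 => /eqP ->.
Qed.

HB.instance Definition _ :=
  Lmodule_isNormed.Build R[i] bop norm_add normZ norm_eq0.

Lemma bop_normE f : `|f| = (opnorm f)%:C. Proof. by []. Qed.

Lemma bop_normP f x : `|f x| <= `|f| * `|x|. Proof. exact: opnormP. Qed.

Lemma bop_normM f g : `|f * g| <= `|f| * `|g|.
Proof.
rewrite !bop_normE -rmorphM/= lecR; apply: opnorm_le => [x|].
  apply: (le_trans (opnormP f (g x))); rewrite rmorphM/= -mulrA.
  by apply: ler_wpM2l; [rewrite ler0c opnorm_ge0|exact: opnormP].
by rewrite mulr_ge0 ?opnorm_ge0.
Qed.

End bounded_operators.

Lemma bounded_linear_fun_continuous (R : realType) (V W : normedModType R[i])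
    (f : V -> W) (c : R) :
  linear f -> (forall x, `|f x| <= c%:C * `|x|) -> continuous f.
Proof.
move=> lf fc.
pose g : {linear V -> W} := HB.pack f (GRing.isLinear.Build _ _ _ _ f lf).
apply: (@bounded_linear_continuous _ _ _ g); apply/linear_boundedP.
exists c%:C; split; first by apply/complex_realP; exists c.
move=> r cr x; apply: (le_trans (fc x)).
by rewrite ler_wpM2r// ltW.
Qed.

Lemma bop_bounded_subproof (R : realType) (V : normedModType R[i]) (f : V -> V)
    (c : R) : linear f -> (forall x, `|f x| <= c%:C * `|x|) ->
  f \in @bop_pred R V.
Proof.
move=> lf fc; apply/asboolP; split=> //.
exact: bounded_linear_fun_continuous fc.
Qed.

Lemma bop_mull_continuous (R : realType) (V : normedModType R[i]) (f : bop V) :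
  continuous (fun g : bop V => f * g).
Proof.
apply: (@bounded_linear_fun_continuous _ _ _ _ (opnorm f)) => [c g h|g].
  by apply: bop_ext => x; rewrite bop_mulE !bop_addE !bop_scaleE linearP.
exact: bop_normM.
Qed.

Lemma bop_mulr_continuous (R : realType) (V : normedModType R[i]) (f : bop V) :
  continuous (fun g : bop V => g * f).
Proof.
apply: (@bounded_linear_fun_continuous _ _ _ _ (opnorm f)) => [c g h|g].
  exact: bop_ext.
by rewrite mulrC; exact: bop_normM.
Qed.

Section lp_delta.
Variables (R : realType) (p : R) (p1 : 1 <= p).

Lemma lp_uniq_sum_le (X : choiceType) (x : lpspace p1 X) (s : seq X) : uniq s ->
  \sum_(i <- s) normc (x i) `^ p <= lp_norm p x `^ p.
Proof.
move=> us; rewrite (perm_big (enum_fset [fset i in s]%fset)); last first.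
  by apply: uniq_perm => // i; rewrite inE.
exact: (lp_fin_sum_le p1 [fset i in s]%fset (lp_valP x)).
Qed.

Lemma lp_delta_subproof (X : choiceType) (r : X) :
  (fun i => (i == r)%:R : R[i]) \in lp_pred p X.
Proof.
suff [] : (fun i => (i == r)%:R : R[i]) \in lp_pred p X /\
    lp_norm p (fun i => (i == r)%:R : R[i]) <= 1 by [].
have p0 : p != 0 by rewrite gt_eqF// (lt_le_trans _ p1).
apply: lp_norm_bound => // F; rewrite powR1.
have z i : i != r -> normc ((i == r)%:R : R[i]) `^ p = 0.
  by move=> /negPf ->; rewrite normc0 powR0.
have [rF|rF] := boolP (r \in F); last first.
  rewrite big1_seq// => i /andP[_ iF]; apply: z.
  by apply: contraNneq rF => <-.
by rewrite (bigD1_seq r)//= eqxx normc1 powR1 big1 ?addr0.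
Qed.

Definition lp_delta (X : choiceType) (r : X) : lpspace p1 X :=
  LpSpace p1 (lp_delta_subproof r).

Variable X : pointedType.
Local Notation B := (bop (lpspace p1 X)).

Fact bop_oner_neq0 : (1 : B) != 0.
Proof.
apply/eqP => /(congr1 (fun f : B => f (lp_delta point) point)).
by rewrite bop_oneE /= eqxx => /eqP; rewrite oner_eq0.
Qed.

HB.instance Definition _ := GRing.PzSemiRing_isNonZero.Build B bop_oner_neq0.

Fact bop_scalerAl (c : R[i]) (f g : B) : c *: (f * g) = (c *: f) * g.
Proof. exact: bop_ext. Qed.
HB.instance Definition _ := GRing.Lmodule_isLalgebra.Build R[i] B bop_scalerAl.

Fact bop_scalerAr (c : R[i]) (f g : B) : c *: (f * g) = f * (c *: g).
Proof. by apply: bop_ext => x; rewrite bop_mulE !bop_scaleE linearZ. Qed.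
HB.instance Definition _ := GRing.Lalgebra_isAlgebra.Build R[i] B bop_scalerAr.

End lp_delta.

Section cuntz_generators.
Variables (R : realType) (p : R) (p1 : 1 <= p) (k : nat) (j : 'I_k).
Local Notation V := (lpspace p1 nat).
Implicit Type x : V.

Let k0 : (0 < k)%N. Proof. exact: leq_ltn_trans (ltn_ord j). Qed.
Let p0 : p != 0. Proof. by rewrite gt_eqF// (lt_le_trans _ p1). Qed.

(* coordinate form of the operators given on the canonical basis by
   S_j delta_r = delta_(kr+j), and by T_j delta_(kl+j) = delta_l and
   T_j delta_r = 0 for other r; see cuntz_S_delta and cuntz_T_delta *)
Definition cuntz_S_fun x : nat -> R[i] :=
  fun r => if (r %% k)%N == j then x (r %/ k)%N else 0.

Definition cuntz_T_fun x : nat -> R[i] := fun l => x (k * l + j)%N.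

Lemma cuntz_S_bound x :
  cuntz_S_fun x \in lp_pred p nat /\ lp_norm p (cuntz_S_fun x) <= lp_norm p x.
Proof.
apply: (lp_norm_bound p1); [exact: lp_norm_ge0 | move=> F].
rewrite (bigID (fun r => (r %% k)%N == j))/= addrC big1 ?add0r; last first.
  by move=> r /negPf rj; rewrite /cuntz_S_fun rj normc0 powR0.
rewrite (eq_bigr (fun r => normc (x (r %/ k)%N) `^ p)); last first.
  by move=> r rj; rewrite /cuntz_S_fun rj.
rewrite -big_filter -(big_map (divn^~ k) xpredT (fun i => normc (x i) `^ p)).
apply: lp_uniq_sum_le; rewrite map_inj_in_uniq ?filter_uniq ?fset_uniq//.
move=> a b; rewrite !mem_filter => /andP[/eqP aj _] /andP[/eqP bj _] ab.
by rewrite (divn_eq a k) (divn_eq b k) aj bj ab.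
Qed.

Lemma cuntz_T_bound x :
  cuntz_T_fun x \in lp_pred p nat /\ lp_norm p (cuntz_T_fun x) <= lp_norm p x.
Proof.
apply: (lp_norm_bound p1); [exact: lp_norm_ge0 | move=> F].
rewrite -(big_map (fun l => k * l + j)%N xpredT (fun i => normc (x i) `^ p)).
apply: lp_uniq_sum_le; rewrite map_inj_uniq ?fset_uniq// => a b /addIn/eqP.
by rewrite eqn_pmul2l// => /eqP.
Qed.

Definition cuntz_S_val x : V := LpSpace p1 (cuntz_S_bound x).1.
Definition cuntz_T_val x : V := LpSpace p1 (cuntz_T_bound x).1.

Lemma cuntz_S_subproof : cuntz_S_val \in @bop_pred R V.
Proof.
apply: (@bop_bounded_subproof _ _ _ 1) => [c x y|x].
  apply: lpspace_ext => r; rewrite lp_valD lp_valZ /= /cuntz_S_fun.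
  by case: ifP => _ //; rewrite mulr0 addr0.
by rewrite mul1r !lpnormE lecR; exact: (cuntz_S_bound x).2.
Qed.

Lemma cuntz_T_subproof : cuntz_T_val \in @bop_pred R V.
Proof.
apply: (@bop_bounded_subproof _ _ _ 1) => [c x y|x]; first exact: lpspace_ext.
by rewrite mul1r !lpnormE lecR; exact: (cuntz_T_bound x).2.
Qed.

Definition cuntz_S : bop V := Bop cuntz_S_subproof.
Definition cuntz_T : bop V := Bop cuntz_T_subproof.

Lemma cuntz_S_delta r : cuntz_S (lp_delta p1 r) = lp_delta p1 (k * r + j)%N.
Proof.
apply: lpspace_ext => i /=; rewrite /cuntz_S_fun/=.
case: (eqVneq (i %% k)%N (j : nat)) => [ij|ij].
  by rewrite [in RHS](divn_eq i k) ij mulnC eqn_add2r eqn_pmul2l.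
case: eqVneq => // iE; case/eqP: ij.
by rewrite iE mulnC modnMDl modn_small.
Qed.

Lemma cuntz_T_delta l : cuntz_T (lp_delta p1 (k * l + j)%N) = lp_delta p1 l.
Proof.
apply: lpspace_ext => i /=; rewrite /cuntz_T_fun/=.
by rewrite eqn_add2r eqn_pmul2l.
Qed.

Lemma cuntz_T_delta0 r : (forall l, r <> k * l + j)%N ->
  cuntz_T (lp_delta p1 r) = 0.
Proof.
move=> rj; apply: lpspace_ext => i /=; rewrite /cuntz_T_fun/=.
by case: eqP => // /esym/rj.
Qed.

Lemma cuntz_TS : cuntz_T * cuntz_S = 1.
Proof.
apply: bop_ext => x; apply: lpspace_ext => l /=.
by rewrite /cuntz_T_fun /= /cuntz_S_fun mulnC modnMDl modn_small// eqxx
  divnMDl// divn_small// addn0.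
Qed.

End cuntz_generators.

Section banach_algebra_generated.
Variables (R : realType) (p : R) (p1 : 1 <= p) (X : pointedType).
Local Notation B := (bop (lpspace p1 X)).

(* the unit is required of the subalgebras; this makes no difference for the
   Cuntz generators, since cuntz_TS below yields the unit *)
Definition banach_algebra_gen (G : set B) : set B :=
  \bigcap_(A in [set A : set B | [/\ closed A,
    GRing.subalg_closed (mem A) & G `<=` A]]) A.

Lemma subalg_banach_algebra_gen (G : set B) :
  GRing.subalg_closed (mem (banach_algebra_gen G)).
Proof.
split.
- by apply/mem_set => A [_ [A1 _ _] _]; exact: set_mem A1.
- move=> c f g /set_mem fG /set_mem gG; apply/mem_set => A hA.
  have [_ [_ lA _] _] := hA.
  by apply/set_mem/lA; apply/mem_set; [exact: fG|exact: gG].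
- move=> f g /set_mem fG /set_mem gG; apply/mem_set => A hA.
  have [_ [_ _ mA] _] := hA.
  by apply/set_mem/mA; apply/mem_set; [exact: fG|exact: gG].
Qed.

Definition closed_span (G : set B) : set B :=
  \bigcap_(A in [set A : set B | [/\ closed A,
    GRing.submod_closed (mem A) & G `<=` A]]) A.

Lemma sub_closed_span (G : set B) : G `<=` closed_span G.
Proof. by move=> f Gf A [_ _ GA]; exact: GA. Qed.

Lemma closed_span_min (G A : set B) : closed A ->
  GRing.submod_closed (mem A) -> G `<=` A -> closed_span G `<=` A.
Proof. by move=> cA sA GA f; exact. Qed.

Lemma closed_closed_span (G : set B) : closed (closed_span G).
Proof. by apply: closed_bigI => A []. Qed.

Lemma submod_closed_span (G : set B) :
  GRing.submod_closed (mem (closed_span G)).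
Proof.
split.
- by apply/mem_set => A [_ [A0 _] _]; exact: set_mem A0.
- move=> c f g /set_mem fG /set_mem gG; apply/mem_set => A hA.
  have [_ [_ lA] _] := hA.
  by apply/set_mem/lA; apply/mem_set; [exact: fG|exact: gG].
Qed.

Lemma closed_span_mul (G : set B) :
  (forall f g, G f -> G g -> G (f * g)) ->
  forall f g, closed_span G f -> closed_span G g -> closed_span G (f * g).
Proof.
move=> GM; have [S0 SL] := submod_closed_span G.
have GS f g : G f -> closed_span G g -> closed_span G (f * g).
  move=> Gf; apply: (@closed_span_min _ [set g | closed_span G (f * g)]).
  - apply: (preimage_closed _ (@closed_closed_span G)) => h _.
    exact: bop_mull_continuous.
  - split; first by apply/mem_set; rewrite /= mulr0; exact: set_mem S0.
    move=> c h1 h2 /set_mem/= h1S /set_mem/= h2S; apply/mem_set => /=.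
    by rewrite mulrDr -scalerAr; apply/set_mem/SL; exact/mem_set.
  - by move=> h Gh; apply: sub_closed_span; exact: GM.
move=> f g Sf Sg; move: f Sf.
apply: (@closed_span_min _ [set f | closed_span G (f * g)]).
- apply: (preimage_closed _ (@closed_closed_span G)) => h _.
  exact: bop_mulr_continuous.
- split; first by apply/mem_set; rewrite /= mul0r; exact: set_mem S0.
  move=> c h1 h2 /set_mem/= h1S /set_mem/= h2S; apply/mem_set => /=.
  by rewrite mulrDl -scalerAl; apply/set_mem/SL; exact/mem_set.
- by move=> h Gh; exact: GS.
Qed.

End banach_algebra_generated.

Section spatial_tensor_product.
Variables (R : realType) (p : R) (p1 : 1 <= p) (m : nat).
Local Notation N0m := {ffun 'I_m -> nat}.
Local Notation l1 := (lpspace p1 nat).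
Local Notation lm := (lpspace p1 N0m).
Implicit Types (xi : 'I_m -> l1) (a b : 'I_m -> bop l1) (t u : bop lm).

Lemma tensor_vec_subproof xi : (fun r : N0m => \prod_i xi i (r i)) \in lp_pred p N0m.
Proof.
pose f (r : N0m) : R[i] := \prod_i xi i (r i).
suff [] : f \in lp_pred p N0m /\ lp_norm p f <= \prod_i lp_norm p (xi i) by [].
have normc_prod (z : 'I_m -> R[i]) : normc (\prod_i z i) = \prod_i normc (z i).
  by apply: (big_morph _ (@normcM R)); exact: normc1.
have powR_prod (z : 'I_m -> R) : (forall i, 0 <= z i) ->
    (\prod_i z i) `^ p = \prod_i z i `^ p.
  move=> z0; elim: (index_enum _) => [|i s IH]; first by rewrite !big_nil powR1.
  by rewrite !big_cons powRM ?IH// prodr_ge0.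
apply: (lp_norm_bound p1) => [|F].
  by apply: prodr_ge0 => i _; exact: lp_norm_ge0.
rewrite powR_prod; last by move=> i; exact: lp_norm_ge0.
pose g i s := normc (xi i s) `^ p.
have g0 i s : 0 <= g i s by exact: powR_ge0.
pose M := (\max_(r <- F) \max_i r i)%N.
have rM (r : N0m) i : r \in F -> (r i < M.+1)%N.
  move=> rF; apply: (@leq_trans (\max_i r i).+1).
    by rewrite ltnS; exact: (leq_bigmax (F := fun i => r i)).
  by rewrite ltnS; exact: (leq_bigmax_seq (F := fun r : N0m => (\max_i r i)%N) r rF).
pose c (r : N0m) : {ffun 'I_m -> 'I_M.+1} := [ffun i => inord (r i)].
pose H (h : {ffun 'I_m -> 'I_M.+1}) := \prod_i g i (h i).
have H0 h : 0 <= H h by exact: prodr_ge0.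
have -> : \sum_(r <- F) normc (f r) `^ p = \sum_(h <- [seq c r | r <- F]) H h.
  rewrite big_map; apply: eq_big_seq => r rF.
  rewrite /f normc_prod powR_prod; last by move=> i; exact: normc_ge0.
  by apply: eq_bigr => i _; rewrite ffunE inordK// rM.
rewrite big_uniq/=; last first.
  rewrite map_inj_in_uniq ?fset_uniq// => r r' rF r'F /ffunP cc.
  apply/ffunP => i; have := cc i; rewrite !ffunE => /(congr1 val).
  by rewrite /= !inordK ?rM.
apply: (@le_trans _ _ (\sum_h H h)).
  by rewrite [leRHS](bigID (mem [seq c r | r <- F]))/= lerDl sumr_ge0.
rewrite /H -(bigA_distr_bigA (fun i (s : 'I_M.+1) => g i s)).
apply: ler_prod => i _; rewrite sumr_ge0//=.
rewrite -(big_mkord xpredT (g i)).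
by apply: lp_uniq_sum_le; exact: iota_uniq.
Qed.

Definition tensor_vec xi : lm := LpSpace p1 (tensor_vec_subproof xi).

(* t is the operator a_1 (x) ... (x) a_m; this determines t, since the
   elementary tensors xi_1 (x) ... (x) xi_m span a dense subspace *)
Definition is_tensor a t : Prop :=
  forall xi, t (tensor_vec xi) = tensor_vec (fun i => a i (xi i)).

Definition elementary_tensors (A : 'I_m -> set (bop l1)) : set (bop lm) :=
  [set t | exists2 a, (forall i, A i (a i)) & is_tensor a t].

Definition spatial_tensor (A : 'I_m -> set (bop l1)) : set (bop lm) :=
  closed_span (elementary_tensors A).

Lemma is_tensor1 : is_tensor (fun=> 1) 1.
Proof. by []. Qed.

Lemma is_tensorM a b t u : is_tensor a t -> is_tensor b u ->
  is_tensor (fun i => a i * b i) (t * u).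
Proof. by move=> ta ub xi; rewrite bop_mulE ub ta. Qed.

Lemma subalg_spatial_tensor (A : 'I_m -> set (bop l1)) :
  (forall i, GRing.subalg_closed (mem (A i))) ->
  GRing.subalg_closed (mem (spatial_tensor A)).
Proof.
move=> subA; have [S0 SL] := submod_closed_span (elementary_tensors A).
split => //.
- apply/mem_set; apply: sub_closed_span; exists (fun=> 1); last exact: is_tensor1.
  by move=> i; have [A1 _ _] := subA i; exact: set_mem A1.
- move=> t u /set_mem tS /set_mem uS; apply/mem_set.
  apply: closed_span_mul => // {tS uS} t' u' [a Aa ta] [b Ab ub].
  exists (fun i => a i * b i); last exact: is_tensorM.
  move=> i; have [_ _ AM] := subA i.
  by apply/set_mem/AM; exact/mem_set.
Qed.

End spatial_tensor_product.

Section cuntz_algebras.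
Variables (R : realType) (p : R) (p1 : 1 <= p).

Definition cuntz (k : nat) : set (bop (lpspace p1 nat)) :=
  banach_algebra_gen [set a | exists j : 'I_k,
    a = cuntz_S p1 j \/ a = cuntz_T p1 j].

Variables (m : nat) (k : 'I_m -> nat).

Definition cuntz_tensor_set : set (bop (lpspace p1 {ffun 'I_m -> nat})) :=
  spatial_tensor (fun i => cuntz (k i)).

Lemma cuntz_tensor_subproof : GRing.subalg_closed (mem cuntz_tensor_set).
Proof.
by apply: subalg_spatial_tensor => i; exact: subalg_banach_algebra_gen.
Qed.

Record cuntz_tensor := CuntzTensor {
  cuntz_tensor_val :> bop (lpspace p1 {ffun 'I_m -> nat}) ;
  cuntz_tensor_valP : cuntz_tensor_val \in mem cuntz_tensor_set }.

HB.instance Definition _ := [isSub for cuntz_tensor_val].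
HB.instance Definition _ := [Choice of cuntz_tensor by <:].
HB.instance Definition _ := GRing.SubChoice_isSubAlgebra.Build
  R[i] (bop (lpspace p1 {ffun 'I_m -> nat})) (mem cuntz_tensor_set)
  cuntz_tensor (GRing.subalg_closed_semi cuntz_tensor_subproof).

End cuntz_algebras.

(* Main.v *)
(* Write S_i, T_i for the generators of the i-th tensor factor (two of each
   suffice) and phi for the homomorphism. For p <> 2 an isometry of l^p preserves
   disjointness of supports, so surjective isometries permute the basis vectors
   up to scalars. Applied to the images of the unimodular functions
   1 + (i - 1) S_i T_i, this shows that phi (S_i T_i) is diagonal, and then that
   phi (S_i) maps each basis vector delta_r to a multiple of some
   delta_(sigma_i r). As phi (S_i) is a norm limit of combinations of local
   operators, sigma_i moves each coordinate by a bounded distance in the tree on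
   nat in which the parent of r is r %/ l. Applying words in the commuting maps
   sigma_i to one point yields an injective Lipschitz map from the grid N^m to a
   product of n trees. The asymptotic dimension of the latter is at most n, and
   that of the former at least m by Lebesgue's covering theorem. *)
Require Import Defs.
From HB Require Import structures.
From mathcomp Require Import all_boot all_order all_algebra complex.
From mathcomp Require Import all_classical all_reals all_analysis.
From mathcomp Require Import zify ring lra.

Set Implicit Arguments.
Unset Strict Implicit.
Unset Printing Implicit Defensive.

Import Order.TTheory GRing.Theory Num.Theory.
Import numFieldNormedType.Exports.

Local Open Scope nat_scope.

(** * Sperner's lemma on the Kuhn triangulation of the cube *)

(** Counting basis vectors gives no bound, since all the sets N^m with m > 0 are in bijection. The
    obstruction is coarse, and it survives because a norm limit of local operators still has its
    large matrix entries near the diagonal. Contractivity becomes isometry through one-sided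
    inverses: if g f = 1 and both are contractive, then f is isometric. The function 1 + (i - 1) S T
    is preferred to the reflection 1 - 2 S T because the square of the latter is 1, so that its
    image could exchange two basis vectors; the eigenvalues 1 and i, whose sum is nonzero, exclude
    this. Two generators per factor are used to form words S^a S' in which the final S' marks the
    end of the run of S, so that distinct exponents lead to distinct basis vectors. *)

Lemma big_addb_involution (I : finType) (P F : pred I) (h : I -> I) :
  involutive h -> (forall i, P i -> P (h i)) -> (forall i, P i -> h i != i) ->
  (forall i, P i -> F (h i) = F i) -> \big[addb/false]_(i | P i) F i = false.
Proof.
move=> hK hP hn hF.
have hPE i : P (h i) = P i by apply/idP/idP => /hP; rewrite ?hK.
(* [r] holds for exactly one index of each pair [i], [h i]. *)
pose r i := enum_rank (h i) < enum_rank i.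
rewrite (bigID r)/= [X in addb X _](reindex_inj (inv_inj hK))/=.
rewrite (eq_big (fun i => P i && ~~ r i) F) ?addbb//.
  move=> i; rewrite hPE; apply: andb_id2l => Pi; rewrite /r hK -leqNgt ltn_neqAle.
  by rewrite (inj_eq val_inj) (inj_eq enum_rank_inj) eq_sym hn.
by move=> i /andP[]; rewrite hPE => /hF.
Qed.

(** On the labels of a simplex this gives the labels of the facet opposite to vertex [a]. *)
Definition rem_nth (T : Type) a (s : seq T) := take a s ++ drop a.+1 s.

Lemma perm_rem_nth (T : eqType) (x0 : T) a (s : seq T) : a < size s ->
  perm_eq s (nth x0 s a :: rem_nth a s).
Proof.
move=> a_s; rewrite -{1}(cat_take_drop a s) (drop_nth x0)// -cat1s.
by rewrite perm_catCA.
Qed.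

(* A simplex has an odd number of facets carrying the labels 0, ..., d - 1
   exactly when it carries all the labels 0, ..., d. *)
Lemma rainbow_parity d (s : seq nat) : size s = d.+1 -> all (leq^~ d) s ->
  perm_eq s (iota 0 d.+1) =
  \big[addb/false]_(0 <= a < d.+1) perm_eq (rem_nth a s) (iota 0 d).
Proof.
move=> size_s s_le; pose q t := perm_eq s (t :: iota 0 d).
have -> : \big[addb/false]_(0 <= a < d.+1) perm_eq (rem_nth a s) (iota 0 d) =
    odd (count q s).
  rewrite -[s in count _ s](mkseq_nth 0) size_s /mkseq count_map -sum1_count.
  rewrite [in RHS]big_mkcond (big_morph odd oddD (erefl _ : odd 0 = false)).
  rewrite -[d.+1 in RHS]subn0 -/(index_iota 0 d.+1).
  apply: eq_big_nat => a /=; rewrite -size_s => a_s.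
  rewrite /q; have /permPl-> := perm_rem_nth 0 a_s; rewrite perm_cons.
  by case: ifP.
have iotaE : perm_eq (iota 0 d.+1) (d :: iota 0 d).
  by rewrite -addn1 iotaD add0n /= -cat1s perm_catC.
have [/hasP[t ts qt]|/hasPn nq] := boolP (has q s); last first.
  have -> : count q s = 0.
    by apply/eqP; rewrite -leqn0 leqNgt -has_count; apply/hasPn.
  apply/negP => ps; have /nq : d \in s by rewrite (perm_mem ps) mem_iota add0n leqnn.
  by rewrite /q (permPl ps) iotaE.
(* Only one value [t] satisfies [q]; it occurs in [s] once if t = d and twice if t < d. *)
have qE u : q u = (u == t).
  apply/idP/eqP => [qu|->//]; apply/eqP.
  have /permP/(_ (pred1 u)) : perm_eq (u :: iota 0 d) (t :: iota 0 d).
    by rewrite -(permPl qu).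
  by rewrite /= eqxx eq_sym => /addIn; case: eqP.
rewrite (eq_count qE) (permP qt) /= eqxx oddD -/(count_mem t (iota 0 d)).
rewrite count_uniq_mem ?iota_uniq// mem_iota/= add0n (permPr iotaE).
rewrite -/(q d) qE.
have := allP s_le _ ts; rewrite leq_eqVlt => /orP[/eqP->|td].
  by rewrite eqxx ltnn.
by rewrite td gtn_eqF.
Qed.

Lemma eq_rem_nth_map (T : Type) (f g : nat -> T) a n : a < n ->
  (forall b, b != a -> f b = g b) ->
  rem_nth a [seq f b | b <- iota 0 n] = rem_nth a [seq g b | b <- iota 0 n].
Proof.
move=> an fg; rewrite /rem_nth -!map_take -!map_drop -!map_cat.
apply/eq_in_map => b bs; apply: fg; apply: contraTneq bs => ->.
have := @perm_rem_nth _ 0 a (iota 0 n); rewrite size_iota => /(_ an)/perm_uniq.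
by rewrite iota_uniq nth_iota// add0n => /esym/andP[].
Qed.

(** Exchanging two consecutive directions of a Kuhn simplex replaces its vertex [a.+1] alone, which
    gives the neighbour across the opposite facet. Lists that are too short are left unchanged, so
    the map is an involution without side conditions. *)
Definition swap_nth (T : Type) a (s : seq T) :=
  if drop a s is p :: q :: t then take a s ++ q :: p :: t else s.

Lemma size_swap_nth (T : Type) a (s : seq T) : size (swap_nth a s) = size s.
Proof.
rewrite /swap_nth; case E: (drop a s) => [|p [|q t]]//.
by rewrite -[s in RHS](cat_take_drop a s) E !size_cat.
Qed.

Lemma swap_nth_split (T : Type) a (s : seq T) : a.+1 < size s ->
  exists p q t, s = take a s ++ p :: q :: t /\ swap_nth a s = take a s ++ q :: p :: t.
Proof.
move=> a_s; have := size_drop a s; rewrite /swap_nth.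
case: (drop a s) (cat_take_drop a s) => [|p [|q t]]/= e; [lia|lia|] => _.
by exists p, q, t.
Qed.

Lemma swap_nthK (T : Type) a : involutive (@swap_nth T a).
Proof.
move=> s; have [a_s|sa] := ltnP a.+1 (size s); last first.
  by rewrite {2}/swap_nth; have := size_drop a s; rewrite /swap_nth;
    case E: (drop a s) => [|p [|q t]]//=; rewrite ?E//; lia.
have [p [q [t [sE ->]]]] := swap_nth_split a_s.
have sz : size (take a s) = a by rewrite size_takel//; lia.
by rewrite /swap_nth drop_size_cat// take_size_cat// -sE.
Qed.

Lemma perm_swap_nth (T : eqType) a (s : seq T) : perm_eq (swap_nth a s) s.
Proof.
rewrite /swap_nth; case E: (drop a s) => [|p [|q t]]//.
rewrite -[X in perm_eq _ X](cat_take_drop a s) E.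
by rewrite perm_cat2l; apply/permP => i /=; rewrite addnCA.
Qed.

Lemma mem_take_swap_nth (T : eqType) a b (s : seq T) : b != a.+1 ->
  take b (swap_nth a s) =i take b s.
Proof.
move=> ba; have [a_s|sa] := ltnP a.+1 (size s); last first.
  rewrite /swap_nth; have := size_drop a s.
  by case: (drop a s) => [|p [|q t]]//=; lia.
have [p [q [t [sE ->]]]] := swap_nth_split a_s.
have sz : size (take a s) = a by rewrite size_takel//; lia.
move=> i; rewrite [in RHS]sE !take_cat sz.
case: ltnP => // ab; rewrite !mem_cat; congr (_ || _).
case E: (b - a) => [|[|c]]//=; first by move: E ba => /eqP; lia.
by rewrite !inE orbCA.
Qed.

(* The simplices of the Kuhn triangulation of [0, N]^m: the one attached to
   (x, w) has the vertices x, x + e_(w_0), x + e_(w_0) + e_(w_1), ... *)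
Section kuhn.
Variables (m N' : nat).
Local Notation N := N'.+1.
Local Notation simp d := ({ffun 'I_m -> 'I_N} * d.-tuple 'I_m)%type.
Local Notation point := {ffun 'I_m -> nat}.

Definition kuhn_vertex (x : {ffun 'I_m -> 'I_N}) (w : seq 'I_m) a : point :=
  [ffun i => x i + (i \in take a w)].

(* the simplices that triangulate the face x_d = ... = x_(m-1) = 0 *)
Definition kuhn_simplex d (s : simp d) :=
  [&& uniq s.2, all (fun i : 'I_m => i < d) s.2 &
      [forall i : 'I_m, (d <= i) ==> (s.1 i == 0 :> nat)]].

(** Boundary conditions of Sperner type: [lam0] bounds the labels on the face x_d = ... = x_(m-1) =
    0 by d, which permits induction on d; [lamN] keeps facets carrying the label i off the face x_i
    = N. *)
Variable lam : point -> nat.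
Hypothesis lam_le : forall x, lam x <= m.
Hypothesis lam0 : forall (x : point) (i : 'I_m), x i = 0 -> lam x <= i.
Hypothesis lamN : forall (x : point) (i : 'I_m), x i = N -> lam x != i.

Definition kuhn_labels d (s : simp d) :=
  [seq lam (kuhn_vertex s.1 s.2 a) | a <- iota 0 d.+1].

Definition kuhn_parity d :=
  \big[addb/false]_(s : simp d | kuhn_simplex s)
    perm_eq (kuhn_labels s) (iota 0 d.+1).

Lemma kuhn_vertex_face d (s : simp d) a (i : 'I_m) :
  kuhn_simplex s -> d <= i -> kuhn_vertex s.1 s.2 a i = 0.
Proof.
move=> /and3P[_ /allP sd /forallP/(_ i)/implyP si] di; rewrite ffunE.
rewrite (eqP (si di)) add0n; case: (boolP (i \in _)) => // /mem_take /sd.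
by rewrite ltnNge di.
Qed.

Lemma kuhn_labels_le d (s : simp d) : d <= m -> kuhn_simplex s ->
  all (leq^~ d) (kuhn_labels s).
Proof.
move=> dm ks; apply/allP => _ /mapP[a _ ->].
move: dm; rewrite leq_eqVlt => /orP[/eqP dm|dm]; first by apply: leq_trans (lam_le _) _; rewrite dm.
by apply: (@lam0 _ (Ordinal dm)); exact: kuhn_vertex_face.
Qed.

(** Facets opposite to inner vertices are shared by two simplices that differ by a swap of
    directions, so they cancel in pairs. *)
Lemma kuhn_interior d a : a < d ->
  \big[addb/false]_(s : simp d.+1 | kuhn_simplex s)
    perm_eq (rem_nth a.+1 (kuhn_labels s)) (iota 0 d.+1) = false.
Proof.
move=> ad.
have szP (w : d.+1.-tuple 'I_m) : size (swap_nth a w) == d.+1.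
  by rewrite size_swap_nth size_tuple.
pose h (s : simp d.+1) : simp d.+1 := (s.1, Tuple (szP s.2)).
apply: (big_addb_involution (h := h)).
- by move=> [x w]; congr pair; apply: val_inj; exact: swap_nthK.
- move=> [x w] /and3P/= [w1 w2 w3]; apply/and3P; split=> //=.
    by rewrite (perm_uniq (perm_swap_nth _ _)).
  by rewrite (perm_all _ (perm_swap_nth _ _)).
- move=> [x w] /and3P/= [w1 _ _]; apply/eqP => -[] /(congr1 val)/=.
  have a_w : a.+1 < size w by rewrite size_tuple.
  have [p [q [t [wE ->]]]] := swap_nth_split a_w.
  rewrite {2}wE => /eqP; rewrite eqseq_cat// eqxx/= => /andP[/eqP qp _].
  by move: w1; rewrite wE cat_uniq qp /= mem_head !andbF.
- move=> [x w] _; congr perm_eq; apply: eq_rem_nth_map; first by lia.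
  move=> b ba; congr lam; apply/ffunP => i; rewrite !ffunE/=.
  by rewrite mem_take_swap_nth.
Qed.

Definition last_dir d (w : d.+1.-tuple 'I_m) := tnth w ord_max.

(** The neighbour across the facet opposite to the first vertex: it starts at the second vertex and
    uses the first direction last. The cyclic successor makes this a bijection; the simplices that
    wrap around land on those with coordinate 0 in their last direction, which are counted
    separately. *)
Definition kuhn_shift d (s : simp d.+1) : simp d.+1 :=
  ([ffun i => if i == thead s.2 then ordS (s.1 i) else s.1 i], [tuple of rot 1 s.2]).

Definition kuhn_unshift d (s : simp d.+1) : simp d.+1 :=
  ([ffun i => if i == last_dir s.2 then ord_pred (s.1 i) else s.1 i],
   [tuple of rotr 1 s.2]).

Lemma last_dir_rot d (w : d.+1.-tuple 'I_m) : last_dir [tuple of rot 1 w] = thead w.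
Proof.
case/tupleP: w => a w; rewrite /last_dir (tnth_nth a)/= theadE rot1_cons.
by rewrite nth_rcons size_tuple ltnn eqxx.
Qed.

Lemma kuhn_shiftK d : cancel (@kuhn_shift d) (@kuhn_unshift d).
Proof.
move=> [x w]; rewrite /kuhn_unshift /kuhn_shift/= last_dir_rot; congr pair.
  by apply/ffunP => i; rewrite !ffunE; case: (i == _) => //; exact: ordSK.
by apply: val_inj; rewrite /= rotK.
Qed.

Lemma thead_lt d (s : simp d.+1) : kuhn_simplex s -> thead s.2 < d.+1.
Proof. by move=> /and3P[_ /allP ws _]; apply: ws; exact: mem_tnth. Qed.

Lemma kuhn_shift_simplex d (s : simp d.+1) : kuhn_simplex (kuhn_shift s) = kuhn_simplex s.
Proof.
case: s => x w; rewrite /kuhn_simplex/= rot_uniq; congr andb.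
rewrite (eq_all_r (mem_rot 1 w)).
apply: andb_id2l => /allP ws; apply: eq_forallb => i.
case: (leqP d.+1 i) => //= di; rewrite ffunE ifF//.
apply/eqP => iw; move: (ws _ (mem_tnth ord0 w)); rewrite -/(thead w) -iw.
by rewrite ltnNge di.
Qed.

Lemma kuhn_shift_vertex d (s : simp d.+1) b :
  s.1 (thead s.2) != N' :> nat -> uniq s.2 -> b < d.+1 ->
  kuhn_vertex (kuhn_shift s).1 (kuhn_shift s).2 b = kuhn_vertex s.1 s.2 b.+1.
Proof.
case: s => x w /= xN uw bd; apply/ffunP => i; rewrite !ffunE/=.
case/tupleP: w => a w in xN uw *; rewrite theadE in xN *; rewrite /= rot1_cons.
rewrite -cats1 takel_cat ?size_tuple// inE.
have [->|ia] /= := eqVneq i a; last by [].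
move: uw => /= /andP[aw _]; rewrite /= modn_small; last first.
  by have := ltn_ord (x a); lia.
have -> : (a \in take b w) = false by apply: contraNF aw; exact: mem_take.
by rewrite addn0 addn1.
Qed.

Definition front_facet d (s : simp d.+1) :=
  perm_eq [seq lam (kuhn_vertex s.1 s.2 b) | b <- iota 0 d.+1] (iota 0 d.+1).
Definition back_facet d (s : simp d.+1) :=
  perm_eq [seq lam (kuhn_vertex s.1 s.2 b.+1) | b <- iota 0 d.+1] (iota 0 d.+1).

Lemma back_facetN d (s : simp d.+1) : kuhn_simplex s -> back_facet s ->
  s.1 (thead s.2) != N' :> nat.
Proof.
move=> ks /perm_mem fs; have : (thead s.2 : nat) \in iota 0 d.+1.
  by rewrite mem_iota add0n thead_lt.
rewrite -fs => /mapP[b _ lb]; apply/eqP => sN.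
have vN : kuhn_vertex s.1 s.2 b.+1 (thead s.2) = N.
  by rewrite ffunE sN; case: (tupleP s.2) => a w; rewrite theadE/= mem_head addn1.
by have := lamN vN; rewrite -lb eqxx.
Qed.

(** The front facet does not move in the last direction, so that coordinate vanishes on it and its
    labels are at most [last_dir]; the label d must occur among them. *)
Lemma front_facet0 d (s : simp d.+1) : kuhn_simplex s -> front_facet s ->
  s.1 (last_dir s.2) = 0 :> nat -> last_dir s.2 = d :> nat.
Proof.
move=> /and3P[us ws _] /perm_mem fs s0; have : d \in iota 0 d.+1.
  by rewrite mem_iota add0n leqnn.
rewrite -fs => /mapP[b]; rewrite mem_iota add0n => bd lb; apply/eqP; rewrite eqn_leq.
have := allP ws _ (mem_tnth ord_max s.2); rewrite ltnS => ->/=.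
suff: lam (kuhn_vertex s.1 s.2 b) <= last_dir s.2 by rewrite -lb.
apply: lam0; rewrite ffunE s0 add0n.
have sz : d < size s.2 by rewrite size_tuple.
rewrite /last_dir (tnth_nth (last_dir s.2)) in_take// ?index_uniq ?mem_nth//=.
by apply/eqP; rewrite eqb0 -leqNgt; case/andP: bd.
Qed.

Lemma last_dirE d (w : d.+1.-tuple 'I_m) i : last_dir w = last i w.
Proof. by rewrite /last_dir (tnth_nth i) -nth_last size_tuple. Qed.

(** Dropping the last direction identifies the front facets in x_d = 0 with the simplices of
    dimension d. *)
Lemma kuhn_boundary d (dm : d < m) :
  \big[addb/false]_(s : simp d.+1 | kuhn_simplex s && (s.1 (last_dir s.2) == 0 :> nat))
    front_facet s = kuhn_parity d.
Proof.
pose e : 'I_m := Ordinal dm.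
rewrite (eq_bigr (fun s => if last_dir s.2 == e then front_facet s else false)); last first.
  move=> s /andP[ks /eqP s0]; case: ifPn => // se; apply/negP => fs.
  by case/eqP: se; apply: val_inj; exact: front_facet0 fs s0.
rewrite -big_mkcondr.
pose h (s : simp d) : simp d.+1 := (s.1, [tuple of rcons s.2 e]).
pose h' (s : simp d.+1) : simp d :=
  (s.1, [tuple of belast (thead s.2) (behead_tuple s.2)]).
rewrite (reindex_onto h h'); last first.
  move=> [x w] /= /andP[_ /eqP we]; congr pair; apply: val_inj => /=.
  by rewrite -we; case/tupleP: w {we} => a w; rewrite (last_dirE _ a) theadE/= -lastI.
have hE t : thead (h t).2 :: behead (h t).2 = rcons t.2 e.
  exact: (esym (congr1 val (tuple_eta (h t).2))).
apply: eq_big => [[x w]|[x w] _].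
  have -> : h' (h (x, w)) == (x, w).
    apply/eqP; congr pair; apply: val_inj => /=.
    by have := hE (x, w); rewrite lastI => /rcons_inj[].
  rewrite andbT (last_dirE _ e) last_rcons eqxx andbT /kuhn_simplex/=.
  rewrite rcons_uniq all_rcons ltnSn/=.
  have eE (i : 'I_m) : (i == e) = (i == d :> nat) by [].
  apply/andP/and3P => [[/and3P[/andP[ew uw] /allP wd /forallP x0] xe]|
      [uw /allP wd /forallP x0]].
    split=> //.
      apply/allP => i iw; rewrite ltn_neqAle -ltnS wd// andbT -eE.
      by apply: contraNneq ew => <-.
    apply/forallP => i; apply/implyP; rewrite leq_eqVlt => /orP[|di].
      by rewrite eq_sym -eE => /eqP->.
    exact: implyP (x0 i) di.
  split; last exact: implyP (x0 e) (leqnn _).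
  apply/and3P; split; rewrite ?uw ?andbT.
  - by apply/negP => /wd; rewrite ltnn.
  - by apply/allP => i /wd/ltnW.
  - by apply/forallP => i; apply/implyP => /ltnW; exact: implyP (x0 i).
congr perm_eq; apply/eq_in_map => b; rewrite mem_iota add0n ltnS /= => bd.
by congr lam; apply/ffunP => i; rewrite !ffunE/= -cats1 takel_cat// size_tuple.
Qed.

(** Pairs of a simplex and a facet labelled 0, ..., d are counted mod 2: shared facets cancel, and
    of the boundary only the face x_d = 0 contributes. *)
Lemma kuhn_step d : d < m -> kuhn_parity d.+1 = kuhn_parity d.
Proof.
move=> dm; rewrite -(kuhn_boundary dm) /kuhn_parity.
have szl (s : simp d.+1) : size (kuhn_labels s) = d.+2 by rewrite size_map size_iota.
transitivity (\big[addb/false]_(s : simp d.+1 | kuhn_simplex s)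
   \big[addb/false]_(0 <= a < d.+2) perm_eq (rem_nth a (kuhn_labels s)) (iota 0 d.+1)).
  by apply: eq_bigr => s ks; rewrite rainbow_parity// kuhn_labels_le.
rewrite exchange_big; set I := iota 0 d.+1.
rewrite big_nat_recl// big_nat_recr//= [X in _ (+) (X (+) _)]big_nat.
rewrite [X in _ (+) (X (+) _)]big1 ?addFb; last first.
  by move=> a ad; apply: kuhn_interior; lia.
set A := (X in addb X _); set B := (X in addb _ X).
have -> : A = \big[addb/false]_(s : simp d.+1 | kuhn_simplex s && (s.1 (thead s.2) != N' :> nat))
    back_facet s.
  rewrite big_mkcondr; apply: eq_bigr => s ks.
  rewrite /rem_nth /kuhn_labels take0 cat0s -map_drop -[drop 1 _]/(iota (1 + 0) d.+1).
  rewrite iotaDl -map_comp.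
  rewrite -[LHS]/(back_facet s); case: ifPn => // /negP nsN; apply/negP => bs.
  exact/nsN/back_facetN.
have -> : B = \big[addb/false]_(s : simp d.+1 | kuhn_simplex s) front_facet s.
  apply: eq_bigr => s _; rewrite /rem_nth drop_oversize ?szl// cats0.
  by rewrite /kuhn_labels -map_take take_iota (minn_idPl _).
rewrite [X in addb _ X](bigID (fun s : simp d.+1 => s.1 (last_dir s.2) == 0 :> nat)).
rewrite /= addbCA [X in addb _ X](_ : _ = false) ?addbF//.
apply/negbTE; rewrite negb_add; apply/eqP.
rewrite [RHS](reindex_inj (can_inj (@kuhn_shiftK d))).
apply: eq_big => [s|s /andP[ks sN]].
  rewrite kuhn_shift_simplex last_dir_rot ffunE eqxx /=; congr (_ && _).
  have := ltn_ord (s.1 (thead s.2)); rewrite ltnS leq_eqVlt.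
  by case: eqVneq => [->|_]//=; rewrite ?modnn// => sN; rewrite modn_small.
congr perm_eq; apply/eq_in_map => b; rewrite mem_iota /= add0n => bd.
by rewrite kuhn_shift_vertex//; case/and3P: ks.
Qed.

Lemma kuhn_parity0 : kuhn_parity 0 = true.
Proof.
pose s0 : simp 0 := ([ffun=> ord0], [tuple]).
have s0P : kuhn_simplex s0.
  by rewrite /kuhn_simplex /=; apply/forallP => i; rewrite ffunE.
rewrite /kuhn_parity (big_pred1 s0) => [|[x w]].
  have := kuhn_labels_le (leq0n m) s0P.
  by rewrite /kuhn_labels /= andbT leqn0 => /eqP->.
apply/idP/eqP => [/and3P[_ _ /forallP x0]|->//].
congr pair; last by rewrite [w]tuple0.
by apply/ffunP => i; apply: val_inj; rewrite ffunE /=; apply/eqP; exact: implyP (x0 i) _.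
Qed.

Lemma kuhn_sperner : exists (x : {ffun 'I_m -> 'I_N}) (w : m.-tuple 'I_m),
  perm_eq [seq lam (kuhn_vertex x w a) | a <- iota 0 m.+1] (iota 0 m.+1).
Proof.
have par d : d <= m -> kuhn_parity d = true.
  by elim: d => [_|d IH dm]; [exact: kuhn_parity0 | rewrite kuhn_step// IH// ltnW].
have := par m (leqnn m); rewrite /kuhn_parity.
have [/existsP[[x w] xwP] _|/existsPn nP] := boolP [exists s : simp m,
  perm_eq (kuhn_labels s) (iota 0 m.+1)]; first by exists x, w.
by rewrite big1// => s _; apply/negbTE/nP.
Qed.

End kuhn.

(** * Lebesgue's covering theorem in discrete form *)

(* As fp separates the points with the same key and colour, the monochromatic
   components have at most M points, hence cannot join opposite faces of the
   cube of side N'.+1. Labelling x by the first i such that its component misses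
   the face x_i = N'.+1, a simplex with m+1 labels needs m+1 colours. *)
Lemma lebesgue_cover m N' n (col : {ffun 'I_m -> nat} -> 'I_n) (M : nat)
    (K : eqType) (key : {ffun 'I_m -> nat} -> K)
    (fp : {ffun 'I_m -> nat} -> 'I_M) : M <= N' ->
  (forall x y : {ffun 'I_m -> nat}, (forall i, x i <= y i <= (x i).+1) ->
     col x = col y -> key x = key y) ->
  (forall x y, key x = key y -> col x = col y -> fp x = fp y -> x = y) ->
  m < n.
Proof.
move=> MN keyP fpP; rewrite ltnNge; apply/negP => nm.
pose N := N'.+1.
pose T := {ffun 'I_m -> 'I_N.+1}.
pose pt (x : T) : {ffun 'I_m -> nat} := [ffun i => x i : nat].
pose adj (x y : T) := [forall i, x i <= y i <= (x i).+1] && (col (pt x) == col (pt y)).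
pose e (x y : T) := adj x y || adj y x.
have e_sym : symmetric e by move=> x y; rewrite /e orbC.
have csym : connect_sym e by exact: sym_connect_sym.
have e_key x y : connect e x y -> key (pt x) = key (pt y) /\ col (pt x) = col (pt y).
  have adjP u v : adj u v -> key (pt u) = key (pt v) /\ col (pt u) = col (pt v).
    move=> /andP[/forallP uv /eqP cuv]; split=> //; apply: keyP => // i.
    by rewrite !ffunE.
  case/connectP => s es ->; elim: s x es => //= z s IH x /andP[/orP[] /adjP [k1 c1] /IH[k2 c2]].
    by rewrite k1 c1.
  by rewrite -k1 -c1.
have touch (x : T) i : x i = ord0 -> ~~ [exists y, connect e x y && (y i == ord_max)].
  move=> x0; apply/negP => /existsP[y /andP[xy /eqP yN]].
  (* Discrete intermediate values: adjacent points differ by at most 1 in coordinate [i], so if the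
     component skipped [v], its points below [v] would be closed under adjacency. *)
  have ex (v : 'I_N.+1) : exists z, connect e x z && (z i == v).
    apply/existsP; apply: contraT => /existsPn nz.
    pose a := [pred z | connect e x z && (z i < v)].
    have ca : fingraph.closed e a.
      apply: (intro_closed csym) => u u' uu'; rewrite inE => /andP[xu uv].
      rewrite inE (connect_trans xu (connect1 uu'))/=.
      have := nz u'; rewrite (connect_trans xu (connect1 uu'))/= => u'v.
      rewrite ltn_neqAle u'v/=.
      case/orP: uu' => /andP[/forallP/(_ i)/andP[ui u'i] _]; first exact: leq_trans u'i uv.
      exact: leq_trans ui (ltnW uv).
    have := closed_connect ca xy; rewrite !inE connect0 xy yN x0/=.
    have := nz x; rewrite connect0 x0/=.
    have := nz y; rewrite xy yN/=.
    rewrite -!val_eqE/=; have := ltn_ord v; lia.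
  pose z v := xchoose (ex v).
  have zP v : connect e x (z v) /\ z v i = v.
    by have /andP[? /eqP] := xchooseP (ex v).
  have : injective (fun v => fp (pt (z v))).
    move=> u v fuv; have [xu zu] := zP u; have [xv zv] := zP v.
    have [ku cu] := e_key _ _ xu; have [kv cv] := e_key _ _ xv.
    have : pt (z u) = pt (z v) by apply: fpP; rewrite -?ku -?cu.
    by move=> /ffunP/(_ i); rewrite !ffunE zu zv => /val_inj.
  by move=> /leq_card; rewrite !card_ord; lia.
pose tch (x : T) i := [exists y, connect e x y && (y i == ord_max)].
(* [clip] is the identity on the cube and extends the labelling to all points. In [lam0], [find]
   returns m when the component meets every face x_i = N. *)
pose clip (x : {ffun 'I_m -> nat}) : T := [ffun i => inord (x i)].
pose lam0 x := find (fun i => ~~ tch x i) (enum 'I_m).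
have lam0E x y : connect e x y -> lam0 x = lam0 y.
  move=> xy; apply: eq_find => i; congr (~~ _); apply: eq_existsb => z.
  by congr andb; exact: (same_connect csym xy).
have idx (i : 'I_m) : index i (enum 'I_m) = i by rewrite index_enum_ord.
have lam_le x : lam0 (clip x) <= m by rewrite -[leqRHS](size_enum_ord m) find_size.
have lam_0 (x : {ffun 'I_m -> nat}) (i : 'I_m) : x i = 0 -> lam0 (clip x) <= i.
  move=> xi; rewrite leqNgt; apply/negP => li.
  have := before_find i li; rewrite nth_ord_enum => /negbFE; apply/negP/touch.
  by apply: val_inj; rewrite ffunE xi /= inordK.
have lam_N (x : {ffun 'I_m -> nat}) (i : 'I_m) : x i = N -> lam0 (clip x) != i.
  move=> xi; apply/eqP => li.
  have hf : has (fun i => ~~ tch (clip x) i) (enum 'I_m).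
    by rewrite has_find size_enum_ord -/(lam0 _) li.
  have := nth_find i hf; rewrite -/(lam0 _) li nth_ord_enum => /negP; apply.
  apply/existsP; exists (clip x); rewrite connect0/=.
  by apply/eqP/val_inj; rewrite ffunE xi /= inordK.
have [x [w xw]] := kuhn_sperner lam_le lam_0 lam_N.
have : uniq [seq lam0 (clip (kuhn_vertex x w a)) | a <- iota 0 m.+1].
  by rewrite (perm_uniq xw) iota_uniq.
pose v a := clip (kuhn_vertex x w a).
have vE a i : v a i = x i + (i \in take a w) :> nat.
  rewrite !ffunE inordK//; have := ltn_ord (x i); case: (i \in _); lia.
(* Among m.+1 vertices with at most m colours two agree; they are adjacent, hence in one component,
   and would have the same label. *)
have : ~~ injectiveb (fun a : 'I_m.+1 => col (pt (v a))).
  by apply/negP => /injectiveP/leq_card; rewrite !card_ord; lia.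
case/injectivePn => a [b ab]; wlog : a b ab / a < b.
  move=> H cab uL; have := ab; rewrite -val_eqE neq_ltn => /orP[] lab.
    exact: (H a b).
  by apply: (H b a) => //; rewrite eq_sym.
move=> {}ab cab uL.
have vab : connect e (v a) (v b).
  apply/connect1/orP; left; rewrite /adj cab eqxx andbT; apply/forallP => i.
  rewrite !vE; case: (boolP (i \in take a w)) => [ia|_]; last by case: (_ \in _); lia.
  have -> : i \in take b w; last by lia.
  by rewrite -(subnKC (ltnW ab)) takeD mem_cat ia.
have := nth_uniq 0 _ _ uL; move=> /(_ a b).
rewrite size_map size_iota !ltn_ord => /(_ isT isT).
rewrite !(nth_map 0) ?size_iota ?ltn_ord// !nth_iota ?ltn_ord// !add0n.
by rewrite (lam0E _ _ vab) eqxx => /esym/eqP abE; rewrite abE ltnn in ab.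
Qed.

(** * Products of trees *)

(* r and s are at bounded distance in the tree on nat in which the parent of r
   is r %/ l *)
Definition tree_near l L r s := exists a b, [/\ a <= L, b <= L & r %/ l ^ b = s %/ l ^ a].

Lemma tree_near_refl l L r : tree_near l L r r.
Proof. by exists 0, 0. Qed.

Lemma tree_near_sym l L r s : tree_near l L r s -> tree_near l L s r.
Proof. by move=> [a [b [aL bL rs]]]; exists b, a. Qed.

Lemma tree_nearW l L L' r s : L <= L' -> tree_near l L r s -> tree_near l L' r s.
Proof. by move=> LL' [a [b [aL bL rs]]]; exists a, b; split=> //; lia. Qed.

Lemma tree_near_trans l L L' r s t :
  tree_near l L r s -> tree_near l L' s t -> tree_near l (L + L') r t.
Proof.
move=> [a [b [aL bL rs]]] [a' [b' [a'L b'L st]]].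
(* Each hypothesis provides an ancestor of [s]; the higher of the two is common to all three
   points. *)
have [ab|/ltnW ba] := leqP b' a.
  exists (a' + (a - b')), b; split; [clear -aL bL a'L b'L; lia|clear -aL bL a'L b'L; lia|].
  by rewrite rs -{1}(subnKC ab) !expnD !divnMA st.
exists a', (b + (b' - a)); split; [clear -aL bL a'L b'L; lia|clear -aL bL a'L b'L; lia|].
by rewrite -st -{2}(subnKC ba) !expnD !divnMA rs.
Qed.

(** * Bands and blocks of levels in one tree *)

Section digits.
Variable l : nat.
Hypothesis l1 : 1 < l.

(** The depth of [t] in the tree, that is, its number of digits in base l, with none for the root
    0. *)
Definition digits t := up_log l t.+1.

Lemma digits_le t e : (digits t <= e) = (t < l ^ e).
Proof.
apply/idP/idP => [te|]; last exact: up_log_min.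
by apply: leq_trans (up_logP _ l1) _; rewrite leq_exp2l.
Qed.

Lemma digits_div t b : digits (t %/ l ^ b) = digits t - b.
Proof.
have dE e : (digits (t %/ l ^ b) <= e) = (digits t - b <= e).
  by rewrite leq_subLR !digits_le ltn_divLR ?expn_gt0 ?(ltnW l1)// -expnD addnC.
by apply/eqP; rewrite eqn_leq dE leqnn -dE leqnn.
Qed.

Variables (w n c : nat).
Hypotheses (w0 : 0 < w) (cn : c <= n).

(* The levels of the tree are cut into bands of width w. Between two
   consecutive bands of index congruent to c mod n.+1 lies a block of bands;
   band_floor is the level of the first of these two bands. *)
Definition band t := digits t %/ w.
Definition block t := (band t + n - c) %/ n.+1.
Definition band_floor t := w * (n.+1 * block t + c - n.+1).
Definition floor_height t := digits t - band_floor t.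
Definition block_root t := t %/ l ^ floor_height t.

Lemma floor_height_le t : floor_height t <= w * n.+2.
Proof.
have ub : band t <= n.+1 * block t + c.
  have := ltn_ceil (band t + n - c) (ltn0Sn n); rewrite -/(block t).
  by lia.
have := ltn_ceil (digits t) w0; rewrite -/(band t) => du.
rewrite /floor_height /band_floor leq_subLR -mulnDr.
apply: leq_trans (ltnW du) _; rewrite mulnC leq_mul2l.
by apply/orP; right; lia.
Qed.

Lemma block_root_inj t t' : block_root t = block_root t' ->
  floor_height t = floor_height t' ->
  t %% l ^ floor_height t = t' %% l ^ floor_height t' -> t = t'.
Proof.
move=> rt et mt; rewrite (divn_eq t (l ^ floor_height t)) mt et.
by rewrite [in RHS](divn_eq t' (l ^ floor_height t')) -/(block_root t') -rt /block_root et.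
Qed.

(** The levels differ by at most w, hence the bands by at most 1, and the block index changes only
    between a band congruent to c and the next one. *)
Lemma block_near t t' : tree_near l w t t' ->
  band t %% n.+1 != c -> band t' %% n.+1 != c -> block t = block t'.
Proof.
wlog tt' : t t' / digits t <= digits t'.
  move=> H ntt tc tc'; have [tt|/ltnW tt] := leqP (digits t) (digits t').
    exact: H.
  by apply/esym; apply: H => //; exact: tree_near_sym.
move=> [a [b [aw bw tE]]] tc tc'.
have := congr1 digits tE; rewrite !digits_div => dE.
have uu : band t <= band t' by exact: leq_div2r.
have uu' : band t' <= (band t).+1.
  have : digits t' <= w + digits t by clear -dE aw; lia.
  by rewrite /band -add1n -divnMDl// mul1n => /leq_div2r->.
rewrite /block.
move: uu; rewrite leq_eqVlt => /orP[/eqP-> //|u1].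
have -> : band t' = (band t).+1 by apply/eqP; rewrite eqn_leq uu' u1.
clear -cn tc.
rewrite (divn_eq (band t) n.+1); have := ltn_pmod (band t) (ltn0Sn n).
move: (band t %% n.+1) (band t %/ n.+1) tc => r q rc rn.
have [r_c|cr] := ltnP r c.
  have -> : q * n.+1 + r + n - c = q * n.+1 + (r + n - c) by lia.
  have -> : (q * n.+1 + r).+1 + n - c = q * n.+1 + (r.+1 + n - c) by lia.
  by rewrite !divnMDl// !divn_small//; lia.
have -> : q * n.+1 + r + n - c = q.+1 * n.+1 + (r - c.+1) by lia.
have -> : (q * n.+1 + r).+1 + n - c = q.+1 * n.+1 + (r - c) by lia.
by rewrite !divnMDl// !divn_small//; lia.
Qed.

(** A whole band congruent to c separates [t] from a floor of positive level. In the first block the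
    truncated subtraction puts the floor at level 0. *)
Lemma floor_height_ge t : 0 < band_floor t -> w <= floor_height t.
Proof.
rewrite muln_gt0 w0/= => f0; have ub : n.+1 * block t + c - n.+1 < band t.
  by have := leq_divM (band t + n - c) n.+1; rewrite -/(block t); lia.
have := leq_divM (digits t) w; rewrite -/(band t) => du.
rewrite /floor_height /band_floor.
apply: leq_trans (leq_sub2r _ du); rewrite (mulnC w) -mulnBl.
by rewrite leq_pmull// subn_gt0.
Qed.

(** The common ancestor is reached within w levels, hence before passing the floor, and from there
    the way to the floor is the same. If the floor is level 0, both block roots are 0. *)
Lemma block_root_near t t' : tree_near l w t t' ->
  band t %% n.+1 != c -> band t' %% n.+1 != c -> block_root t = block_root t'.
Proof.
move=> tt' tc tc'; have bE := block_near tt' tc tc'.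
have fE : band_floor t = band_floor t' by rewrite /band_floor bE.
have [f0|f0] := posnP (band_floor t).
  by rewrite /block_root /floor_height -fE f0 !subn0 !divn_small// -digits_le.
have [a [b [aw bw tE]]] := tt'.
have := congr1 digits tE; rewrite !digits_div => dE.
have hw := floor_height_ge f0.
have hw' : w <= floor_height t' by apply: floor_height_ge; rewrite -fE.
rewrite /block_root -(subnKC (leq_trans bw hw)) -(subnKC (leq_trans aw hw')).
rewrite !expnD !divnMA tE; congr (_ %/ l ^ _).
by rewrite /floor_height -fE subnAC dE subnAC.
Qed.

End digits.

(* A product of n trees has asymptotic dimension at most n: colour x by a class
   mod n.+1 avoided by the bands of its n coordinates. A monochromatic component
   then stays in one block of each tree, below a single vertex. *)
Lemma grid_embedding_dim m n (l : 'I_n -> nat) (hl : forall j, 1 < l j) L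
    (F : {ffun 'I_m -> nat} -> {ffun 'I_n -> nat}) : injective F ->
  (forall x y : {ffun 'I_m -> nat}, (forall i, x i <= y i <= (x i).+1) ->
     forall j, tree_near (l j) L (F x j) (F y j)) ->
  m <= n.
Proof.
move=> injF nearF; pose w := L.+1; have w0 : 0 < w by [].
have near_w (x y : {ffun 'I_m -> nat}) : (forall i, x i <= y i <= (x i).+1) ->
    forall j, tree_near (l j) w (F x j) (F y j).
  by move=> xy j; apply: tree_nearW (nearF _ _ xy j).
pose avoids (x : {ffun 'I_n -> nat}) (c : 'I_n.+1) :=
  [forall j, band (l j) w (x j) %% n.+1 != c].
(* Each of the n coordinates excludes one of the n.+1 colours. *)
have ex_col x : exists c, avoids x c.
  pose g j : 'I_n.+1 := Ordinal (ltn_pmod (band (l j) w (x j)) (ltn0Sn n)).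
  apply/existsP; apply: contraT => /existsPn nav.
  have : [set: 'I_n.+1] \subset g @: 'I_n.
    apply/fintype.subsetP => c _; have := nav c; rewrite negb_forall => /existsP[j].
    by rewrite negbK => /eqP cE; apply/imsetP; exists j => //; apply: val_inj.
  move=> /subset_leq_card; rewrite cardsT card_ord.
  by move=> /leq_trans/(_ (leq_imset_card _ _)); rewrite card_ord ltnn.
pose col (x : {ffun 'I_n -> nat}) := xchoose (ex_col x).
have colP (x : {ffun 'I_n -> nat}) j : band (l j) w (x j) %% n.+1 != col x.
  exact: forallP (xchooseP (ex_col x)) j.
pose key (x : {ffun 'I_n -> nat}) :=
  [ffun j => (block (l j) w n (col x) (x j), block_root (l j) w n (col x) (x j))].
pose W := w * n.+2; pose B := \max_j (l j) ^ W.
(* A coordinate below a known block root is determined by its height over the floor and its last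
   digits; both are bounded, as a block with its floor band spans at most n.+2 bands. *)
pose fp (x : {ffun 'I_n -> nat}) :=
  [ffun j => (inord (floor_height (l j) w n (col x) (x j)) : 'I_W.+1,
   inord (x j %% (l j) ^ floor_height (l j) w n (col x) (x j)) : 'I_B.+1)].
rewrite -ltnS; apply: (@lebesgue_cover m _ n.+1 (col \o F) _ _ (key \o F)
   (enum_rank \o fp \o F) (leqnn _)) => [x y xy cxy|x y kxy cxy fxy].
  move: cxy => /= cxy; apply/ffunP => j; rewrite !ffunE -cxy.
  have cn : col (F x) <= n by rewrite -ltnS.
  have tc := colP (F x) j; have tc' := colP (F y) j; rewrite -cxy in tc'.
  have nxy := near_w _ _ xy j.
  by rewrite (block_near (hl j) w0 cn nxy tc tc') (block_root_near (hl j) w0 cn nxy tc tc').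
apply: injF; apply/ffunP => j.
move/enum_rank_inj/ffunP/(_ j): fxy; move/ffunP/(_ j): kxy; rewrite !ffunE.
move: cxy => /= <- [_ rxy] [] /(congr1 val)/= + /(congr1 val)/=.
have cn : col (F x) <= n by rewrite -ltnS.
have hW t : floor_height (l j) w n (col (F x)) t <= W by exact: floor_height_le.
have hB t : t %% l j ^ floor_height (l j) w n (col (F x)) t <= B.
  apply: leq_trans (leq_bigmax j).
  apply: (@leq_trans (l j ^ floor_height (l j) w n (col (F x)) t)).
    by apply/ltnW/ltn_pmod; rewrite expn_gt0 ltnW.
  by rewrite leq_exp2l.
rewrite !inordK ?ltnS//.
exact: block_root_inj rxy.
Qed.

(** * Grids from commuting embeddings *)

Section orbit.
Variables (m n : nat) (l : 'I_n -> nat) (L : nat).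
Local Notation point := {ffun 'I_n -> nat}.
Variables (s0 s1 : 'I_m -> point -> point).
Hypothesis s0_inj : forall i, injective (s0 i).
Hypothesis s1_inj : forall i, injective (s1 i).
Hypothesis s01 : forall i x y, s0 i x <> s1 i y.
Hypothesis s00C : forall (i j : 'I_m) x, i != j -> s0 i (s0 j x) = s0 j (s0 i x).
Hypothesis s01C : forall (i j : 'I_m) x, i != j -> s0 i (s1 j x) = s1 j (s0 i x).
Hypothesis s0_near : forall i (x : point) j, tree_near (l j) L (x j) (s0 i x j).

(** The range of [s1 i] is disjoint from that of [s0 i], so the inner [s1 i] ends the run of [s0 i]
    and the exponent can be read off. *)
Definition orbit_step (a : {ffun 'I_m -> nat}) i x := iter (a i) (s0 i) (s1 i x).
Definition orbit_word (a : {ffun 'I_m -> nat}) s := foldr (orbit_step a) [ffun=> 0] s.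
Definition orbit_point a := orbit_word a (enum 'I_m).

Lemma orbit_step_inj a b i x y :
  orbit_step a i x = orbit_step b i y -> a i = b i /\ x = y.
Proof.
rewrite /orbit_step; elim: (a i) (b i) => [|c IH] [|d] /=.
- by move=> /s1_inj.
- by move=> /esym/s01.
- by move=> /s01.
- by move=> /s0_inj/IH[-> ->].
Qed.

Lemma orbit_point_inj : injective orbit_point.
Proof.
move=> a b ab; apply/ffunP => i; have : i \in enum 'I_m by rewrite mem_enum.
move: ab; rewrite /orbit_point; elim: (enum _) => //= j s IH /orbit_step_inj[ab ww].
by rewrite inE => /orP[/eqP->//|]; exact: IH.
Qed.

Definition bump_at i (a : {ffun 'I_m -> nat}) : {ffun 'I_m -> nat} :=
  [ffun j => a j + (j == i)].

Lemma orbit_word_bumpN a i s : i \notin s -> orbit_word (bump_at i a) s = orbit_word a s.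
Proof.
elim: s => //= j s IH; rewrite inE negb_or => /andP[ij si]; rewrite IH//.
by rewrite /orbit_step ffunE eq_sym (negPf ij) addn0.
Qed.

(** [s0 i] commutes with the steps of all other indices, so the additional factor can be moved to
    the front. *)
Lemma orbit_point_bump a i : orbit_point (bump_at i a) = s0 i (orbit_point a).
Proof.
rewrite /orbit_point; have := enum_uniq 'I_m.
have : i \in enum 'I_m by rewrite mem_enum.
elim: (enum _) => //= j s IH; rewrite inE => /orP[/eqP<-|si] /andP[js us].
  by rewrite orbit_word_bumpN// /orbit_step ffunE eqxx addn1.
have ij : i != j by apply: contraNneq js => <-.
rewrite IH// /orbit_step ffunE eq_sym (negPf ij) addn0.
by elim: (a j) => [|c IHc] /=; [rewrite s01C | rewrite IHc [RHS]s00C].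
Qed.

Lemma orbit_point_near (a b : {ffun 'I_m -> nat}) : (forall i, a i <= b i <= (a i).+1) ->
  forall j, tree_near (l j) (L * m) (orbit_point a j) (orbit_point b j).
Proof.
(* The coordinates are changed from [a] to [b] one at a time. *)
move=> ab j; pose mix (s : seq 'I_m) : {ffun 'I_m -> nat} :=
  [ffun i => if i \in s then b i else a i].
suff mixP s : tree_near (l j) (L * size s) (orbit_point a j) (orbit_point (mix s) j).
  have := mixP (enum 'I_m); rewrite size_enum_ord.
  by congr tree_near; congr (orbit_point _ _); apply/ffunP => i; rewrite ffunE mem_enum.
elim: s => [|i s IH].
  have -> : mix [::] = a by apply/ffunP => i; rewrite ffunE.
  by rewrite muln0; exact: tree_near_refl.
rewrite mulnS addnC; apply: tree_near_trans IH _.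
have [eq_mix|] := eqVneq (mix (i :: s) i) (mix s i).
  have -> : mix (i :: s) = mix s; last by apply: tree_nearW (tree_near_refl _ 0 _).
  apply/ffunP => k; have [->//|ki] := eqVneq k i.
  by rewrite !ffunE inE (negPf ki).
rewrite !ffunE inE eqxx/=; case: ifP => [|si] bai; first by rewrite eqxx.
have -> : mix (i :: s) = bump_at i (mix s); last by rewrite orbit_point_bump; exact: s0_near.
apply/ffunP => k; rewrite !ffunE inE; have [->|ki] /= := eqVneq k i; last by rewrite addn0.
by rewrite si; have := ab i; lia.
Qed.

Lemma commuting_embeddings_dim : (forall j, 1 < l j) -> m <= n.
Proof.
move=> hl; apply: (grid_embedding_dim hl orbit_point_inj) => x y xy.
exact: orbit_point_near.
Qed.

End orbit.

Local Close Scope nat_scope.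
Local Open Scope classical_set_scope.
Local Open Scope ring_scope.

(** * Isometries of l^p *)

Local Notation normc := Normc.normc.

(** * Strict Clarkson inequalities for two complex numbers *)

Section clarkson.
Variable R : realType.
Implicit Types (u v r p : R) (a b : R[i]).

Lemma powR_superadditive r u v : 1 < r -> 0 < u -> 0 < v ->
  u `^ r + v `^ r < (u + v) `^ r.
Proof.
move=> r1 u0 v0; have powE w : 0 < w -> w `^ r = w * w `^ (r - 1).
  move=> w0; rewrite -[X in X * _]powRr1 ?ltW// -powRD; last by apply/implyP => _; rewrite gt_eqF.
  by rewrite subrKC.
have lt_p w : 0 < w -> w < u + v -> w `^ r < w * (u + v) `^ (r - 1).
  move=> w0 wuv; rewrite powE// ltr_pM2l// gt0_ltr_powR ?nnegrE ?subr_gt0 ?ltW//.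
  by rewrite addr_gt0.
rewrite [ltRHS]powE ?addr_gt0// mulrDl ltrD// lt_p// ?ltrDl ?ltrDr//.
Qed.

Lemma powR_midpoint r u v : 1 <= r -> 0 <= u -> 0 <= v ->
  2 * ((u + v) / 2) `^ r <= u `^ r + v `^ r.
Proof.
move=> r1 u0 v0; have h01 : 0 <= (2^-1 : R) <= 1 by lra.
have /andP[h0 h1] := h01.
have : (2^-1 * u + (1 - 2^-1) * v) `^ r <= 2^-1 * u `^ r + (1 - 2^-1) * v `^ r.
  have := convex_powR r1 (Itv01 h0 h1) (x := u) (y := v).
  by rewrite !convRE/=; apply; rewrite inE/= in_itv/= andbT.
have -> : 1 - 2^-1 = 2^-1 :> R by lra.
have -> : 2^-1 * u + 2^-1 * v = (u + v) / 2 by rewrite mulrDl ![_ / 2]mulrC.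
lra.
Qed.

Lemma normc_sqr (a : R[i]) : normc a ^+ 2 = complex.Re a ^+ 2 + complex.Im a ^+ 2.
Proof. by case: a => x y /=; rewrite sqr_sqrtr// addr_ge0 ?sqr_ge0. Qed.

Lemma normc_parallelogram a b :
  normc (a + b) ^+ 2 + normc (a - b) ^+ 2 = 2 * (normc a ^+ 2 + normc b ^+ 2).
Proof. by rewrite !normc_sqr; case: a b => [x y] [z t] /=; ring. Qed.

Lemma normc_gt0 a : a != 0 -> 0 < normc a.
Proof.
by move=> a0; rewrite lt_def normc_ge0 andbT; apply: contra_neq a0 => /Normc.eq0_normc.
Qed.

(** Put r = 2 / p, A = |a|^p and B = |b|^p. If the inequality failed, convexity of the r-th power
    and the parallelogram law would give (A + B)^r <= A^r + B^r, against strict superadditivity. For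
    p > 2 the same facts are applied to squared moduli with r = p / 2. *)
Lemma clarkson_lt2 p a b : 0 < p -> p < 2 -> a != 0 -> b != 0 ->
  normc (a + b) `^ p + normc (a - b) `^ p < 2 * (normc a `^ p + normc b `^ p).
Proof.
move=> p0 p2 a0 b0; have na := normc_gt0 a0; have nb := normc_gt0 b0.
pose r := 2 / p; have r1 : 1 < r by rewrite ltr_pdivlMr// mul1r.
have powE w : 0 <= w -> (w `^ p) `^ r = w ^+ 2.
  by move=> w0; rewrite -powRrM mulrC divfK ?gt_eqF// powR_mulrn.
rewrite mulrC -ltr_pdivrMr//.
set u := normc (a + b) `^ p; set v := normc (a - b) `^ p.
have uv0 : 0 <= (u + v) / 2 by rewrite divr_ge0 ?addr_ge0 ?powR_ge0.
rewrite ltNge; apply/negP => H.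
have : (normc a `^ p + normc b `^ p) `^ r <= ((u + v) / 2) `^ r.
  rewrite ge0_ler_powR ?nnegrE ?addr_ge0 ?powR_ge0//; lra.
apply/negP; rewrite -ltNge.
apply: le_lt_trans (powR_superadditive r1 (powR_gt0 _ na) (powR_gt0 _ nb)).
have := powR_midpoint (ltW r1) (powR_ge0 _ _ : 0 <= u) (powR_ge0 _ _ : 0 <= v).
rewrite !powE ?normc_ge0//; have := normc_parallelogram a b; lra.
Qed.

Lemma clarkson_gt2 p a b : 2 < p -> a != 0 -> b != 0 ->
  2 * (normc a `^ p + normc b `^ p) < normc (a + b) `^ p + normc (a - b) `^ p.
Proof.
move=> p2 a0 b0; have na := normc_gt0 a0; have nb := normc_gt0 b0.
pose r := p / 2; have r1 : 1 < r by rewrite ltr_pdivlMr// mul1r.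
have powE w : 0 <= w -> w `^ p = (w ^+ 2) `^ r.
  by move=> w0; rewrite -powR_mulrn// -powRrM mulrC divfK.
rewrite !powE ?normc_ge0//.
have := powR_superadditive r1 (exprn_gt0 2 na) (exprn_gt0 2 nb).
have := powR_midpoint (ltW r1) (sqr_ge0 (normc (a + b))) (sqr_ge0 (normc (a - b))).
rewrite normc_parallelogram [2 * (_ + _)]mulrC mulfK//; lra.
Qed.

End clarkson.

Section isometries.
Variables (R : realType) (p : R) (p1 : 1 <= p) (X : choiceType).
Local Notation V := (lpspace p1 X).
Implicit Types (x y : V) (s : bop V).

Let p0 : 0 < p. Proof. exact: lt_le_trans p1. Qed.

Definition lp_power x : R := fine (lp_sum p x).

Lemma lp_sumE x : lp_sum p x = (lp_power x)%:E.
Proof.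
rewrite /lp_power fineK// ge0_fin_numE ?lp_sum_ge0//.
exact/asboolP/(lp_valP x).
Qed.

Lemma lp_powerE x : lp_power x = lp_norm p x `^ p.
Proof.
rewrite /lp_norm -powRrM mulVf ?gt_eqF// powRr1//.
by rewrite fine_ge0// lp_sum_ge0.
Qed.

Lemma lp_power_eq x y : `|x| = `|y| -> lp_power x = lp_power y.
Proof.
move=> xy; have n_eq : lp_norm p x = lp_norm p y := congr1 (@complex.Re R) xy.
by rewrite !lp_powerE n_eq.
Qed.

Lemma esum_lt (f g : X -> R) i : (forall j, 0 <= f j) -> (forall j, f j <= g j) ->
  f i < g i -> (\esum_(j in [set: X]) (g j)%:E < +oo)%E ->
  (\esum_(j in [set: X]) (f j)%:E < \esum_(j in [set: X]) (g j)%:E)%E.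
Proof.
move=> f0 fg fgi goo.
have g0 j : 0 <= g j by exact: le_trans (fg j).
pose d j := if j == i then g i - f i else 0.
have d0 j : 0 <= d j by rewrite /d; case: ifP => // _; rewrite subr_ge0.
have foo : (\esum_(j in [set: X]) (f j)%:E < +oo)%E.
  by apply: le_lt_trans goo; apply: le_esum => j _; rewrite lee_fin.
have dge : ((g i - f i)%:E <= \esum_(j in [set: X]) (d j)%:E)%E.
  apply: esum_ge; exists [set i]; first by split => //; exact: finite_set1.
  by rewrite fsbig_set1 /d eqxx.
apply: (@lt_le_trans _ _ (\esum_(j in [set: X]) ((f j)%:E + (d j)%:E))%E).
  rewrite esumD; [|by move=> *; rewrite lee_fin|by move=> *; rewrite lee_fin].
  apply: (lt_le_trans _ (leeD2l _ dge)).
  rewrite lteDl ?lte_fin ?subr_gt0// ge0_fin_numE//.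
  by apply: esum_ge0 => *; rewrite lee_fin.
apply: le_esum => j _; rewrite -EFinD lee_fin /d; case: eqP => [->|_].
  by rewrite addrC subrK.
by rewrite addr0.
Qed.

Definition lp_disjoint x y := forall i, x i = 0 \/ y i = 0.

(** For p <> 2 all coordinates contribute with the same sign, so this vanishes only for disjoint
    supports. It is built from norms of x, y, x + y and x - y, which a linear isometry preserves. *)
Definition clarkson_gap x y :=
  2 * (lp_power x + lp_power y) - (lp_power (x + y) + lp_power (x - y)).

Lemma lp_valN x i : (- x) i = - x i. Proof. by []. Qed.
Lemma lp_valB x y i : (x - y) i = x i - y i. Proof. by []. Qed.

Lemma esum_double_powers x y : \esum_(i in [set: X]) (2 * (normc (x i) `^ p + normc (y i) `^ p))%:E =
  (2 * (lp_power x + lp_power y))%:E.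
Proof.
have dbl (z : R) : 2 * z = z + z by rewrite mulr_natl mulr2n.
rewrite [in RHS]dbl !EFinD -!lp_sumE /lp_sum.
rewrite -!esumD; try by move=> *; rewrite ?adde_ge0// lee_fin powR_ge0.
by apply: eq_esum => i _; rewrite dbl !EFinD.
Qed.

Lemma esum_sum_diff_powers x y :
  \esum_(i in [set: X]) (normc (x i + y i) `^ p + normc (x i - y i) `^ p)%:E =
  (lp_power (x + y) + lp_power (x - y))%:E.
Proof.
rewrite !EFinD -!lp_sumE /lp_sum.
by rewrite -!esumD; try by move=> *; rewrite ?adde_ge0// lee_fin powR_ge0.
Qed.

Lemma clarkson_eq (a b : R[i]) : a = 0 \/ b = 0 ->
  normc (a + b) `^ p + normc (a - b) `^ p = 2 * (normc a `^ p + normc b `^ p).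
Proof.
by case=> ->; rewrite ?subr0 ?sub0r ?addr0 ?add0r ?normcN Normc.normc0 powR0 ?gt_eqF//; ring.
Qed.

Lemma clarkson_gap0 x y : lp_disjoint x y -> clarkson_gap x y = 0.
Proof.
move=> xy; apply/eqP; rewrite subr_eq0; apply/eqP/EFin_inj.
rewrite -esum_double_powers -esum_sum_diff_powers; apply: eq_esum => i _.
by rewrite clarkson_eq.
Qed.

Lemma clarkson_gap_disjoint x y : p != 2 -> clarkson_gap x y = 0 -> lp_disjoint x y.
Proof.
move=> p2 /eqP; rewrite subr_eq0 => /eqP gap i.
have [xi|xi] := eqVneq (x i) 0; first by left.
have [yi|yi] := eqVneq (y i) 0; first by right.
have norm0 (a b : R[i]) : 0 <= normc a `^ p + normc b `^ p.
  by rewrite addr_ge0 ?powR_ge0.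
have := congr1 EFin gap; rewrite -esum_double_powers -esum_sum_diff_powers => eq_sum.
suff : false by []; move: p2; rewrite neq_lt => /orP[] p2.
- have := @esum_lt (fun i => normc (x i + y i) `^ p + normc (x i - y i) `^ p)
    (fun i => 2 * (normc (x i) `^ p + normc (y i) `^ p)) i.
  rewrite eq_sum ltxx esum_sum_diff_powers ltry; apply=> //; last exact: clarkson_lt2.
  move=> j; have [xj|xj] := eqVneq (x j) 0; first by rewrite clarkson_eq//; left.
  have [yj|yj] := eqVneq (y j) 0; first by rewrite clarkson_eq//; right.
  exact/ltW/clarkson_lt2.
- have := @esum_lt (fun i => 2 * (normc (x i) `^ p + normc (y i) `^ p))
    (fun i => normc (x i + y i) `^ p + normc (x i - y i) `^ p) i.
  rewrite eq_sum ltxx esum_sum_diff_powers ltry; apply=> //; last exact: clarkson_gt2.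
    by move=> j; rewrite mulr_ge0.
  move=> j; have [xj|xj] := eqVneq (x j) 0; first by rewrite clarkson_eq//; left.
  have [yj|yj] := eqVneq (y j) 0; first by rewrite clarkson_eq//; right.
  exact/ltW/clarkson_gt2.
Qed.

Hypothesis p2 : p != 2.

Definition isometric s := forall x, `|s x| = `|x|.

Lemma isometric_disjoint s x y : isometric s -> lp_disjoint x y -> lp_disjoint (s x) (s y).
Proof.
move=> si xy; apply: clarkson_gap_disjoint => //.
rewrite /clarkson_gap -linearD -linearB.
by rewrite !(lp_power_eq (si _)) -/(clarkson_gap x y) clarkson_gap0.
Qed.

End isometries.

(** * Isometries and basis vectors *)

Section atoms.
Variables (R : realType) (p : R) (p1 : 1 <= p) (p2 : p != 2) (X : choiceType).
Local Notation V := (lpspace p1 X).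
Local Notation delta := (@lp_delta R p p1 X).
Implicit Types (x y : V) (f g s t : bop V).

Definition contractive f := forall x, `|f x| <= `|x|.

Lemma bopD f x y : f (x + y) = f x + f y. Proof. exact: linearD. Qed.
Lemma bopB f x y : f (x - y) = f x - f y. Proof. exact: linearB. Qed.
Lemma bopZ f c x : f (c *: x) = c *: f x. Proof. exact: linearZ. Qed.

Lemma left_inverse_isometric f g : contractive f -> contractive g ->
  (forall x, g (f x) = x) -> isometric f.
Proof.
move=> cf cg gf x; apply/le_anti/andP; split; first exact: cf.
by have := cg (f x); rewrite gf.
Qed.

Lemma isometric_eq0 f x : isometric f -> f x = 0 -> x = 0.
Proof. by move=> fi fx; apply/eqP; rewrite -normr_eq0 -fi fx normr0. Qed.

Lemma lp_neq0 x : x != 0 -> exists i, x i != 0.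
Proof.
apply: contra_neqP => /forallNP x0; apply: lpspace_ext => i.
by have /negP := x0 i; rewrite negbK => /eqP.
Qed.

Lemma delta_id i : delta i i = 1. Proof. by rewrite /= eqxx. Qed.

Lemma delta_neq i j : i != j -> delta i j = 0.
Proof. by move=> ij; rewrite /= eq_sym (negPf ij). Qed.

Lemma delta_neq0 i : delta i != 0.
Proof.
apply/eqP => /(congr1 (fun x : V => x i)); rewrite delta_id => /eqP.
by rewrite oner_eq0.
Qed.

Lemma delta_scale_inj c d i j : c != 0 -> c *: delta i = d *: delta j -> i = j.
Proof.
move=> c0 /(congr1 (fun x : V => x i)); rewrite !lp_valZ delta_id mulr1 => cE.
by apply/eqP; apply: contraNT c0; rewrite cE eq_sym => /delta_neq ->; rewrite mulr0.
Qed.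

Lemma delta_split x i : exists y, x = x i *: delta i + y /\ y i = 0.
Proof.
exists (x - x i *: delta i); split; first by rewrite addrC subrK.
by rewrite lp_valB lp_valZ delta_id mulr1 subrr.
Qed.

Lemma disjoint_delta c i y : y i = 0 -> lp_disjoint (c *: delta i) y.
Proof.
move=> yi j; have [->|ji] := eqVneq j i; first by right.
by left; rewrite lp_valZ delta_neq 1?eq_sym// mulr0.
Qed.

(** Two nonzero disjoint parts of [y] would have nonzero disjoint images, whose sum cannot be
    supported at one point. *)
Lemma isometric_atom f y i : isometric f -> f y = delta i ->
  exists j, y = y j *: delta j /\ y j != 0.
Proof.
move=> fi fy; have [j yj] : exists j, y j != 0.
  apply: lp_neq0; apply: contra_neq (delta_neq0 i) => y0.
  by rewrite -fy y0 linear0.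
exists j; split=> //; have [z [yE zj]] := delta_split y j.
suff z0 : z = 0 by rewrite {1}yE z0 addr0.
have dis := isometric_disjoint p2 fi (disjoint_delta (y j) zj).
have fyE : f (y j *: delta j) + f z = delta i by rewrite -bopD -yE.
apply/eqP; apply: contraT => z0.
have [k fzk] : exists k, f z k != 0.
  by apply: lp_neq0; apply: contra_neq z0; exact: isometric_eq0.
have [l fjl] : exists l, f (y j *: delta j) l != 0.
  apply: lp_neq0; apply: contra_neq yj => /(isometric_eq0 fi).
  move=> /(congr1 (fun x : V => x j)); rewrite lp_valZ delta_id mulr1.
  by move->.
have ik : i = k.
  apply/eqP; apply: contraNT fzk => /delta_neq ik.
  have := congr1 (fun x : V => x k) fyE; rewrite lp_valD ik.
  by case: (dis k) => -> ; rewrite ?add0r ?addr0//; move=> ->.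
have il : i = l.
  apply/eqP; apply: contraNT fjl => /delta_neq il.
  have := congr1 (fun x : V => x l) fyE; rewrite lp_valD il.
  by case: (dis l) => -> ; rewrite ?add0r ?addr0//; move=> ->.
by case: (dis i) => /eqP; [rewrite il (negPf fjl) | rewrite ik (negPf fzk)].
Qed.

Lemma isometric_diagonal f i c x : isometric f -> c != 0 ->
  f (delta i) = c *: delta i -> f x i = c * x i.
Proof.
move=> fi c0 fE; have [z [xE zi]] := delta_split x i.
rewrite {1}xE bopD bopZ fE lp_valD !lp_valZ delta_id mulr1 mulrC.
case: (isometric_disjoint p2 fi (disjoint_delta 1 zi) i) => [|->]; last by rewrite addr0.
by rewrite scale1r fE lp_valZ delta_id mulr1 => /eqP; rewrite (negPf c0).
Qed.

Section range_idempotent.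
Variables (s t u v : bop V) (c : R[i]).
Hypotheses (c0 : c != 0) (c1 : 1 + c != 0) (c2 : 2 + c != 0).
Hypotheses (ts : forall x, t (s x) = x) (cs : contractive s) (ct : contractive t).
Hypotheses (uE : forall x, u x = x + c *: s (t x)) (cu : contractive u).
Hypotheses (vE : forall x, v x = x - (c / (1 + c)) *: s (t x)) (cv : contractive v).

(** On the range of the idempotent s t, [u] is multiplication by 1 + c and [v] by its inverse 1 - c
    / (1 + c); on the kernel both are the identity. *)
Lemma uv_id x : u (v x) = x.
Proof.
have stv : s (t (v x)) = s (t x) - (c / (1 + c)) *: s (t x).
  by rewrite vE !bopB !bopZ ts.
rewrite uE stv vE; apply: lpspace_ext => i; rewrite !(lp_valD, lp_valN, lp_valZ).
by field.
Qed.

Lemma st_u x : s (t (u x)) = s (t x) + c *: s (t x).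
Proof. by rewrite uE !bopD !bopZ ts. Qed.

Lemma vu_id x : v (u x) = x.
Proof.
rewrite vE st_u uE; apply: lpspace_ext => i; rewrite !(lp_valD, lp_valN, lp_valZ).
by field.
Qed.

Lemma uu_eq x : u (u x) = (2 + c) *: u x - (1 + c) *: x.
Proof.
rewrite uE st_u uE; apply: lpspace_ext => i; rewrite !(lp_valD, lp_valN, lp_valZ).
by ring.
Qed.

Let ui : isometric u := left_inverse_isometric cu cv vu_id.
Let vi : isometric v := left_inverse_isometric cv cu uv_id.
Let si : isometric s := left_inverse_isometric cs ct ts.

(* Otherwise u (delta i) is a multiple of another delta k, and uu_eq makes
   u (u (delta i)), a multiple of a single delta, nonzero at both i and k. *)
Lemma u_diagonal i : exists2 d, d != 0 & u (delta i) = d *: delta i.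
Proof.
have atom j : exists k d, d != 0 /\ u (delta j) = d *: delta k.
  have [k [uE' k0]] := isometric_atom vi (vu_id (delta j)).
  by exists k, (u (delta j) k).
have [k [d [d0 ud]]] := atom i; have [l [d' [d'0 ud']]] := atom k.
exists d => //; have [ik|ik] := eqVneq i k; first by rewrite ud ik.
have := uu_eq (delta i); rewrite ud bopZ ud' => uu.
have ki : k != i by rewrite eq_sym.
have := congr1 (fun x : V => x i) uu; have := congr1 (fun x : V => x k) uu.
rewrite !lp_valB !lp_valZ !delta_id !(delta_neq ik) !(delta_neq ki) !mulr1 !mulr0.
rewrite subr0 sub0r => uk ui'.
have li : l = i.
  apply/eqP; apply: contraNT c1 => /delta_neq li; rewrite -oppr_eq0 -ui' li !mulr0//.
move/eqP: uk; rewrite li (delta_neq ik) !mulr0 eq_sym mulf_eq0 (negPf c2)/=.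
by rewrite (negPf d0).
Qed.

Lemma isometry_monomial i : exists j d, d != 0 /\ s (delta i) = d *: delta j.
Proof.
have [j sj] : exists j, s (delta i) j != 0.
  by apply: lp_neq0; apply: contra_neq (delta_neq0 i); exact: isometric_eq0.
have [d d0 ud] := u_diagonal j.
(* [s (delta i)] lies in the range of s t, where [u] multiplies by 1 + c, and it does not vanish at
   [j]. *)
have dE : d = 1 + c.
  apply: (mulIf sj); rewrite -(isometric_diagonal _ ui d0 ud) uE ts.
  by rewrite lp_valD lp_valZ mulrDl mul1r.
have stj : s (t (delta j)) = delta j.
  apply: (scalerI c0); apply: (addrI (delta j)).
  by rewrite -uE ud dE scalerDl scale1r.
(* [t (delta j)] is the preimage of [delta j] under the isometry [s], hence a multiple of some
   [delta k]; k <> i would make [s (delta i)] and [s (delta k)] disjoint, though both are nonzero at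
   [j]. *)
have [k [tE tk]] := isometric_atom si stj.
move: (t (delta j) k) tE tk => b tE b0.
have skE : s (delta k) = b^-1 *: delta j.
  by rewrite -[in RHS]stj tE bopZ scalerA mulVf// scale1r.
exists j, b^-1; split; first by rewrite invr_eq0.
have [->//|ik] := eqVneq i k.
have := isometric_disjoint p2 si (disjoint_delta 1 (delta_neq ik : delta i k = 0)) j.
rewrite scale1r skE lp_valZ delta_id mulr1 => -[/eqP|/eqP]; rewrite ?(negPf sj)//.
by rewrite invr_eq0 (negPf b0).
Qed.

End range_idempotent.
End atoms.

(** * Tensor products of Cuntz algebras *)

Section composition_operators.
Variables (R : realType) (p : R) (p1 : 1 <= p) (X : choiceType) (g : X -> option X).
Hypothesis g_inj : forall r r' u, g r = Some u -> g r' = Some u -> r = r'.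
Local Notation V := (lpspace p1 X).
Implicit Type x : V.

Let p0 : p != 0. Proof. by rewrite gt_eqF// (lt_le_trans _ p1). Qed.

(** Both kinds of generators in one tensor factor have this form. As [g] is a pullback, it is the
    quotient by k for [S_j] and r |-> kr + j for [T_j]. *)
Definition pcomp_fun x : X -> R[i] := fun r => oapp x 0 (g r).

Lemma uniq_pmap_partial_inj (s : seq X) : uniq s -> uniq (pmap g s).
Proof.
elim: s => //= r s IH /andP[rs us]; case E: (g r) => [u|]/=; last exact: IH.
rewrite IH// andbT mem_pmap; apply: contra rs => /mapP[r' r's /esym gr'].
by rewrite (g_inj E gr').
Qed.

Lemma pcomp_bound x :
  pcomp_fun x \in lp_pred p X /\ lp_norm p (pcomp_fun x) <= lp_norm p x.
Proof.
apply: (lp_norm_bound p1); [exact: lp_norm_ge0 | move=> F].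
rewrite (eq_bigr (fun i => oapp (fun u => normc (x u) `^ p) 0 (g i))); last first.
  move=> i _; rewrite /pcomp_fun; case: (g i) => // ; rewrite -[LHS]/(normc 0 `^ p).
  by rewrite Normc.normc0 powR0.
rewrite -big_pmap; apply: lp_uniq_sum_le; apply: uniq_pmap_partial_inj.
exact: finmap.fset_uniq.
Qed.

Definition pcomp_val x : V := LpSpace p1 (pcomp_bound x).1.

Lemma pcomp_subproof : pcomp_val \in @bop_pred R V.
Proof.
apply: (@bop_bounded_subproof _ _ _ 1) => [c x y|x].
  apply: lpspace_ext => r; rewrite lp_valD lp_valZ /= /pcomp_fun.
  by case: (g r) => //=; rewrite mulr0 addr0.
by rewrite mul1r !lpnormE lecR; exact: (pcomp_bound x).2.
Qed.

Definition pcomp : bop V := Bop pcomp_subproof.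

Lemma pcompE x r : pcomp x r = oapp x 0 (g r). Proof. by []. Qed.

Lemma pcomp_contractive : contractive pcomp.
Proof. by move=> x; rewrite !lpnormE lecR; exact: (pcomp_bound x).2. Qed.

End composition_operators.

Lemma lp_norm_le (R : realType) (p : R) (p1 : 1 <= p) (X : choiceType)
    (x y : lpspace p1 X) : (forall i, normc (x i) <= normc (y i)) -> `|x| <= `|y|.
Proof.
move=> xy; rewrite !lpnormE lecR.
apply: (lp_norm_bound p1 _ _).2; first exact: lp_norm_ge0.
move=> F; apply: le_trans (lp_fin_sum_le p1 F (lp_valP y)); apply: ler_sum => i _.
by rewrite ge0_ler_powR ?nnegrE ?normc_ge0// (le_trans _ p1).
Qed.

Section tensor_generators.
Variables (R : realType) (p : R) (p1 : 1 <= p) (m : nat) (k : 'I_m -> nat).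
Local Notation N0m := {ffun 'I_m -> nat}.
Local Notation B := (bop (lpspace p1 N0m)).
Variable i : 'I_m.

Definition set_coord (r : N0m) (a : nat) : N0m := [ffun i' => if i' == i then a else r i'].

Definition shift_S j (r : N0m) : option N0m :=
  if (r i %% k i)%N == j then Some (set_coord r (r i %/ k i)%N) else None.
Definition shift_T j (r : N0m) : option N0m := Some (set_coord r (k i * r i + j)%N).

Lemma set_coord_eq r r' a a' : set_coord r a = set_coord r' a' ->
  a = a' /\ forall i', i' != i -> r i' = r' i'.
Proof.
move=> /ffunP rr; split=> [|i' /negPf i'i]; first by have := rr i; rewrite !ffunE eqxx.
by have := rr i'; rewrite !ffunE i'i.
Qed.

Lemma shift_S_inj j r r' u : shift_S j r = Some u -> shift_S j r' = Some u -> r = r'.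
Proof.
rewrite /shift_S; case: eqP => // rj [<-]; case: eqP => // r'j [/set_coord_eq[dE rE]].
apply/ffunP => i'; have [->|/rE//] := eqVneq i' i.
by rewrite (divn_eq (r i) (k i)) (divn_eq (r' i) (k i)) rj r'j dE.
Qed.

Lemma shift_T_inj j r r' u : (0 < k i)%N -> shift_T j r = Some u -> shift_T j r' = Some u -> r = r'.
Proof.
move=> k0 [<-] [/set_coord_eq[/addIn/eqP dE rE]]; apply/ffunP => i'.
have [->|/rE//] := eqVneq i' i.
by apply/eqP; move: dE; rewrite eqn_pmul2l// eq_sym.
Qed.

Hypothesis k0 : (0 < k i)%N.
Variable j : 'I_(k i).

Definition tensor_S : B := pcomp p1 (@shift_S_inj j).
Definition tensor_T : B := pcomp p1 (fun r r' u => @shift_T_inj j r r' u k0).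

Definition at_coord (a : bop (lpspace p1 nat)) i' := if i' == i then a else 1.

Lemma at_coord_prod (a : bop (lpspace p1 nat)) (xi : 'I_m -> lpspace p1 nat) (r : N0m) :
  \prod_i' at_coord a i' (xi i') (r i') = a (xi i) (r i) * \prod_(i' | i' != i) xi i' (r i').
Proof.
rewrite (bigD1 i)//= /at_coord eqxx; congr (_ * _); apply: eq_bigr => i' /negPf ->.
by [].
Qed.

Lemma set_coord_prod (xi : 'I_m -> lpspace p1 nat) (r : N0m) a :
  \prod_i' xi i' (set_coord r a i') = xi i a * \prod_(i' | i' != i) xi i' (r i').
Proof.
rewrite (bigD1 i)//= ffunE eqxx; congr (_ * _); apply: eq_bigr => i' /negPf i'i.
by rewrite ffunE i'i.
Qed.

Lemma tensor_S_is_tensor : is_tensor (at_coord (cuntz_S p1 j)) tensor_S.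
Proof.
move=> xi; apply: lpspace_ext => r; rewrite pcompE [RHS]at_coord_prod.
rewrite /shift_S/= /cuntz_S_fun/=; case: eqP => _ /=; last by rewrite mul0r.
by rewrite set_coord_prod.
Qed.

Lemma tensor_T_is_tensor : is_tensor (at_coord (cuntz_T p1 j)) tensor_T.
Proof.
move=> xi; apply: lpspace_ext => r; rewrite pcompE [RHS]at_coord_prod /=.
by rewrite set_coord_prod.
Qed.

Lemma at_coord_cuntz a : @cuntz R p p1 (k i) a -> forall i', @cuntz R p p1 (k i') (at_coord a i').
Proof.
move=> ka i'; rewrite /at_coord; case: eqP => [->//|_].
have [A1 _ _] := subalg_banach_algebra_gen
  [set a : bop (lpspace p1 nat) | exists j : 'I_(k i'), a = cuntz_S p1 j \/ a = cuntz_T p1 j].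
exact: set_mem A1.
Qed.

Lemma tensor_S_in : tensor_S \in mem (@cuntz_tensor_set R p p1 m k).
Proof.
apply/mem_set; apply: sub_closed_span; exists (at_coord (cuntz_S p1 j)).
  by apply: at_coord_cuntz => A [_ _ GA]; apply: GA; exists j; left.
exact: tensor_S_is_tensor.
Qed.

Lemma tensor_T_in : tensor_T \in mem (@cuntz_tensor_set R p p1 m k).
Proof.
apply/mem_set; apply: sub_closed_span; exists (at_coord (cuntz_T p1 j)).
  by apply: at_coord_cuntz => A [_ _ GA]; apply: GA; exists j; right.
exact: tensor_T_is_tensor.
Qed.

End tensor_generators.

(** * Locality of matrix entries and its stability under norm limits *)

Section locality.
Variables (R : realType) (p : R) (p1 : 1 <= p).

Lemma normc_triangle (a b : R[i]) : normc (a + b) <= normc a + normc b.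
Proof. exact: le_normcD. Qed.

Lemma bop_subE (W : normedModType R[i]) (f g : bop W) x : (f - g) x = f x - g x.
Proof. by []. Qed.

Lemma lp_coord_le (X : choiceType) (x : lpspace p1 X) i : normc (x i) <= lp_norm p x.
Proof.
have := lp_uniq_sum_le x (s := [:: i]) isT; rewrite big_seq1.
apply: contraTT; rewrite -!ltNge => lt_x; apply: gt0_ltr_powR => //.
- exact: lt_le_trans p1.
- by rewrite nnegrE lp_norm_ge0.
- by rewrite nnegrE normc_ge0.
Qed.

Lemma lp_norm_delta (X : choiceType) (r : X) : lp_norm p (lp_delta p1 r) = 1.
Proof.
have -> : 1 = 1 `^ p^-1 :> R by rewrite powR1.
congr (_ `^ _); rewrite /lp_sum.
rewrite (_ : \esum_(i in [set: X]) _ = 1%:E)//.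
rewrite -(@esum_set1 R X r (fun=> 1%:E)) ?lee_fin//.
rewrite [RHS]esum_mkcond; apply: eq_esum => i _; rewrite in_set1.
have [->|ir] := eqVneq i r; first by rewrite delta_id Normc.normc1 powR1.
by rewrite delta_neq 1?eq_sym// Normc.normc0 powR0// gt_eqF// (lt_le_trans _ p1).
Qed.

Lemma matrix_entry_le (X : choiceType) (f : bop (lpspace p1 X)) r r' :
  normc (f (lp_delta p1 r) r') <= opnorm f.
Proof.
apply: le_trans (lp_coord_le _ _) _.
have := opnormP f (lp_delta p1 r); rewrite !lpnormE -rmorphM/= lecR => /le_trans; apply.
by rewrite -[leRHS]mulr1 ler_wpM2l ?opnorm_ge0 ?lp_norm_delta.
Qed.

Section matrix_local.
Variables (X : pointedType) (E : nat -> X -> X -> Prop).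
Hypothesis E_mono : forall L L' r r', (L <= L')%N -> E L r r' -> E L' r r'.
Local Notation B := (bop (lpspace p1 X)).

(** The bound [L] may grow as [e] decreases, which makes the condition closed in norm; a uniform
    bound for all nonzero entries would not be. *)
Definition matrix_local : set B := [set f : B | forall e : R, 0 < e -> exists L,
  forall r r', e <= normc (f (lp_delta p1 r) r') -> E L r r'].

Lemma matrix_localD f g : matrix_local f -> matrix_local g -> matrix_local (f + g).
Proof.
move=> lf lg e e0; have e20 : 0 < e / 2 by rewrite divr_gt0.
have [L fL] := lf _ e20; have [L' gL] := lg _ e20.
exists (maxn L L') => r r'; rewrite bop_addE lp_valD => ele.
have [le_f|lt_f] := leP (e / 2) (normc (f (lp_delta p1 r) r')).
  by apply: E_mono (fL _ _ le_f); exact: leq_maxl.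
apply: E_mono (gL _ _ _); first exact: leq_maxr.
have := normc_triangle (f (lp_delta p1 r) r') (g (lp_delta p1 r) r'); lra.
Qed.

Lemma matrix_localZ c f : matrix_local f -> matrix_local (c *: f).
Proof.
move=> lf e e0; have d0 : 0 < e / (normc c + 1).
  by rewrite divr_gt0// ltr_wpDl ?normc_ge0.
have [L fL] := lf _ d0; exists L => r r'; rewrite bop_scaleE lp_valZ => ele.
apply: fL; rewrite ler_pdivrMr ?ltr_wpDl ?normc_ge0//.
apply: le_trans ele _; rewrite Normc.normcM mulrC ler_wpM2l ?normc_ge0// lerDl//.
Qed.

Lemma submod_closed_matrix_local : GRing.submod_closed (mem matrix_local).
Proof.
split.
  apply/mem_set => e e0; exists 0%N => r r'.
  by rewrite -[_ r']/(0 : R[i]) Normc.normc0 leNgt e0.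
move=> c f g /set_mem lf /set_mem lg; apply/mem_set.
by apply: matrix_localD => //; exact: matrix_localZ.
Qed.

Lemma closed_matrix_local : closed matrix_local.
Proof.
move=> f clf e e0; have e20 : 0 < e / 2 by rewrite divr_gt0.
have e2C : 0 < ((e / 2)%:C)%C :> R[i] by rewrite ltcR.
have [g [lg fg]] := clf _ (nbhsx_ballx f _ e2C).
have [L gL] := lg _ e20; exists L => r r' ele; apply: gL.
have lt_fg : normc (f (lp_delta p1 r) r' - g (lp_delta p1 r) r') < e / 2.
  rewrite -lp_valB -bop_subE; apply: le_lt_trans (matrix_entry_le (f - g) r r') _.
  by move: fg; rewrite -ball_normE/= bop_normE ltcR.
have := normc_triangle (f (lp_delta p1 r) r' - g (lp_delta p1 r) r') (g (lp_delta p1 r) r').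
rewrite subrK; lra.
Qed.

End matrix_local.

Section monomial.
Variable l : nat.
Hypothesis l0 : (0 < l)%N.
Local Notation B := (bop (lpspace p1 nat)).

(* c may be 0, as for T_j; unlike the condition on single matrix entries, this
   one is clearly stable under products *)
Definition local_monomial : set B := [set f : B | exists L, forall r, exists r' c,
  f (lp_delta p1 r) = c *: lp_delta p1 r' /\ tree_near l L r r'].

Lemma local_monomialM f g : local_monomial f -> local_monomial g -> local_monomial (f * g).
Proof.
move=> [L fL] [L' gL]; exists (L' + L)%N => r.
have [r' [c [gE rr']]] := gL r; have [r'' [d [fE rr'']]] := fL r'.
exists r'', (c * d); split; last exact: tree_near_trans rr' rr''.
by rewrite bop_mulE gE bopZ fE scalerA.
Qed.

Lemma local_monomial1 : local_monomial 1.
Proof.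
exists 0%N => r; exists r, 1; rewrite scale1r; split=> //; exact: tree_near_refl.
Qed.

Lemma local_monomial_S (j : 'I_l) : local_monomial (cuntz_S p1 j).
Proof.
exists 1%N => r; exists (l * r + j)%N, 1; rewrite scale1r cuntz_S_delta; split=> //.
by exists 1%N, 0%N; split=> //; rewrite expn0 divn1 expn1 mulnC divnMDl// divn_small// addn0.
Qed.

Lemma local_monomial_T (j : 'I_l) : local_monomial (cuntz_T p1 j).
Proof.
exists 1%N => r; have [rj|rj] := eqVneq (r %% l)%N (j : nat).
  exists (r %/ l)%N, 1; rewrite scale1r [in LHS](divn_eq r l) rj mulnC cuntz_T_delta.
  by split=> //; exists 0%N, 1%N; split=> //; rewrite expn0 divn1 expn1.
exists r, 0; split; last exact: tree_near_refl.
rewrite scale0r cuntz_T_delta0// => q rE; case/eqP: rj.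
by rewrite rE mulnC modnMDl modn_small.
Qed.

Lemma cuntz_matrix_local : @cuntz R p p1 l `<=` matrix_local (tree_near l).
Proof.
move=> f /(_ (closed_span local_monomial)) cf.
have {cf} : closed_span local_monomial f.
  apply: cf; split; first exact: closed_closed_span.
    have [_ SL] := submod_closed_span local_monomial; split=> //.
      by apply/mem_set; apply: sub_closed_span; exact: local_monomial1.
    move=> g h /set_mem gS /set_mem hS; apply/mem_set.
    by apply: closed_span_mul => //; exact: local_monomialM.
  move=> _ [j [->|->]]; apply: sub_closed_span.
    exact: local_monomial_S.
  exact: local_monomial_T.
apply: closed_span_min; first exact: closed_matrix_local.
  by apply: submod_closed_matrix_local => L L' r r'; exact: tree_nearW.
move=> g [L gL] e e0; exists L => r r'; have [r'' [c [-> rr'']]] := gL r.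
rewrite lp_valZ; have [<- //|r''r'] := eqVneq r'' r'.
by rewrite delta_neq// mulr0 Normc.normc0 leNgt e0.
Qed.

End monomial.

Section tensor_local.
Variables (n : nat) (l : 'I_n -> nat).
Hypothesis l0 : forall j, (0 < l j)%N.
Local Notation N0n := {ffun 'I_n -> nat}.

Definition coord_near L (r r' : N0n) := forall j, tree_near (l j) L (r j) (r' j).

Lemma delta_tensor (r : N0n) : lp_delta p1 r = tensor_vec (fun j => lp_delta p1 (r j)).
Proof.
apply: lpspace_ext => r' /=; have [->|rr'] := eqVneq r' r.
  by rewrite big1// => j _; rewrite eqxx.
have [j jP] : exists j, r' j != r j.
  apply/existsP; apply: contraNT rr'; rewrite negb_exists => /forallP rr'.
  by apply/eqP/ffunP => j; have := rr' j; rewrite negbK => /eqP.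
by rewrite (bigD1 j)//= (negPf jP) mul0r.
Qed.

Lemma is_tensor_local (a : 'I_n -> bop (lpspace p1 nat)) t :
  (forall j, matrix_local (tree_near (l j)) (a j)) -> is_tensor a t ->
  matrix_local coord_near t.
Proof.
move=> la ta e e0.
(* An entry of [t] is a product of n entries, each at most M in modulus. As M >= 1, a product of at
   least e forces every factor to be at least e / M^n. *)
pose M := 1 + \sum_j opnorm (a j).
have M1 : 1 <= M by rewrite lerDl sumr_ge0// => j _; exact: opnorm_ge0.
have M0 : 0 < M by exact: lt_le_trans M1.
have aM j r r' : normc (a j (lp_delta p1 r) r') <= M.
  apply: le_trans (matrix_entry_le _ _ _) _.
  rewrite /M (bigD1 j)//= addrCA lerDl addr_ge0// sumr_ge0// => i _.
  exact: opnorm_ge0.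
have d0 : 0 < e / M ^+ n by rewrite divr_gt0// exprn_gt0.
have [L LP] := choice (fun j => la j _ d0).
exists (\max_j L j)%N => r r'; rewrite delta_tensor ta => ele j.
apply: (tree_nearW (leq_bigmax j)); apply: LP; rewrite ler_pdivrMr ?exprn_gt0//.
apply: le_trans ele _ => /=.
rewrite (big_morph _ (@Normc.normcM R) (@Normc.normc1 R)) (bigD1 j)//= ler_wpM2l ?normc_ge0//.
apply: (@le_trans _ _ (\prod_(i < n | i != j) M)).
  by apply: ler_prod => i _; rewrite normc_ge0 aM.
rewrite prodr_const; apply: ler_weXn2l => //.
by rewrite -[leqRHS]card_ord max_card.
Qed.

Lemma cuntz_tensor_local : @cuntz_tensor_set R p p1 n l `<=` matrix_local coord_near.
Proof.
apply: closed_span_min; first exact: closed_matrix_local.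
  by apply: submod_closed_matrix_local => L L' r r' LL' rr' j; exact: tree_nearW (rr' j).
move=> t [a al ta]; apply: is_tensor_local ta => j.
exact: cuntz_matrix_local (al j).
Qed.

End tensor_local.
End locality.

Section tensor_relations.
Variables (R : realType) (p : R) (p1 : 1 <= p) (m : nat) (k : 'I_m -> nat).
Hypothesis k0 : forall i, (0 < k i)%N.
Local Notation S i j := (@tensor_S R p p1 m k i j).
Local Notation T i j := (@tensor_T R p p1 m k i (k0 i) j).
Implicit Type x : lpspace p1 {ffun 'I_m -> nat}.

Lemma set_coord_id (r : {ffun 'I_m -> nat}) i a b :
  a = r i -> set_coord i (set_coord i r b) a = r.
Proof.
by move=> ->; apply/ffunP => i'; rewrite !ffunE; case: eqP => [->|].
Qed.

Lemma tensor_SE i (j : 'I_(k i)) x r :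
  S i j x r = if (r i %% k i)%N == j then x (set_coord i r (r i %/ k i)%N) else 0.
Proof. by rewrite pcompE /shift_S; case: ifP. Qed.

Lemma tensor_TE i (j : 'I_(k i)) x r : T i j x r = x (set_coord i r (k i * r i + j)%N).
Proof. by []. Qed.

Lemma tensor_TS i (j j' : 'I_(k i)) x : T i j (S i j' x) = if j == j' then x else 0.
Proof.
apply: lpspace_ext => r; rewrite tensor_TE tensor_SE ffunE eqxx.
rewrite mulnC modnMDl modn_small// -val_eqE.
case: eqP => _ //; rewrite set_coord_id//.
by rewrite divnMDl// divn_small// addn0.
Qed.

Lemma tensor_ST i (j : 'I_(k i)) x r :
  S i j (T i j x) r = if (r i %% k i)%N == j then x r else 0.
Proof.
rewrite tensor_SE tensor_TE; case: eqP => // rj; rewrite set_coord_id//.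
by rewrite ffunE eqxx [RHS](divn_eq (r i) (k i)) rj mulnC.
Qed.

Lemma tensor_SSC i i' (j : 'I_(k i)) (j' : 'I_(k i')) x : i != i' ->
  S i j (S i' j' x) = S i' j' (S i j x).
Proof.
move=> ii'; apply: lpspace_ext => r; rewrite !tensor_SE !ffunE.
rewrite (eq_sym i') (negPf ii'); case: ifP => _; case: ifP => _ //.
congr (lp_val x _); apply/ffunP => a; rewrite !ffunE.
by case: eqP => [->|]; case: eqP => // ii; case/eqP: ii'.
Qed.

(** Each coordinate is multiplied by 1 or by 1 + w, both of modulus 1. *)
Lemma tensor_ST_contractive i (j : 'I_(k i)) (w : R[i]) (f : bop (lpspace p1 {ffun 'I_m -> nat})) :
  normc (1 + w) = 1 -> (forall x, f x = x + w *: S i j (T i j x)) -> contractive f.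
Proof.
move=> w1 fE x; rewrite fE; apply: lp_norm_le => r.
rewrite lp_valD lp_valZ tensor_ST; case: ifP => _; last by rewrite mulr0 addr0.
by rewrite -{1}[x r]mul1r -mulrDl Normc.normcM w1 mul1r.
Qed.

End tensor_relations.

(** * Images of the generators under the homomorphism *)

Section homomorphism.
Variables (R : realType) (p : R) (p1 : 1 <= p) (p2 : p != 2).
Variables (m n : nat) (k : 'I_m -> nat) (l : 'I_n -> nat).
Hypotheses (hk : forall i, (2 <= k i)%N) (hl : forall j, (2 <= l j)%N).
Variable phi : {lrmorphism cuntz_tensor p1 k -> cuntz_tensor p1 l}.
Hypothesis phi_contr : forall a : cuntz_tensor p1 k,
  `|cuntz_tensor_val (phi a)| <= `|cuntz_tensor_val a|.
Local Notation point := {ffun 'I_n -> nat}.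
Local Notation delta := (@lp_delta R p p1 point).

Let k0 i : (0 < k i)%N := ltnW (hk i).

Definition alg_S i j : cuntz_tensor p1 k := CuntzTensor (@tensor_S_in R p p1 m k i j).
Definition alg_T i j : cuntz_tensor p1 k := CuntzTensor (@tensor_T_in R p p1 m k i (k0 i) j).

Lemma phi1 : phi 1 = 1. Proof. exact: rmorph1. Qed.
Lemma phi0 : phi 0 = 0. Proof. exact: rmorph0. Qed.
Lemma phiD a b : phi (a + b) = phi a + phi b. Proof. exact: rmorphD. Qed.
Lemma phiM a b : phi (a * b) = phi a * phi b. Proof. exact: rmorphM. Qed.
Lemma phiZ c a : phi (c *: a) = c *: phi a.
Proof. exact: linearZ. Qed.

Lemma phi_contractive a : contractive (cuntz_tensor_val a) ->
  contractive (cuntz_tensor_val (phi a)).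
Proof.
move=> ca x; apply: le_trans (bop_normP _ _) _; rewrite -[leRHS]mul1r ler_wpM2r//.
apply: le_trans (phi_contr a) _; rewrite bop_normE.
have -> : (1 : R[i]) = (1%:C)%C by [].
by rewrite lecR; apply: opnorm_le => // y; rewrite mul1r.
Qed.

Lemma alg_TS i (j j' : 'I_(k i)) : alg_T j * alg_S j' = if j == j' then 1 else 0.
Proof.
apply: val_inj; apply: bop_ext => x.
transitivity (if j == j' then x else 0); first by rewrite -(tensor_TS k0 j j' x).
by case: eqP.
Qed.

Lemma alg_SSC i i' (j : 'I_(k i)) (j' : 'I_(k i')) : i != i' ->
  alg_S j * alg_S j' = alg_S j' * alg_S j.
Proof. by move=> ii'; apply: val_inj; apply: bop_ext => x; exact: tensor_SSC. Qed.

Lemma phi_TS i (j j' : 'I_(k i)) x :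
  cuntz_tensor_val (phi (alg_T j)) (cuntz_tensor_val (phi (alg_S j')) x) =
  if j == j' then x else 0.
Proof.
have := phiM (alg_T j) (alg_S j'); rewrite alg_TS.
by case: eqP => _; rewrite ?phi1 ?phi0 => /(congr1 (fun a => cuntz_tensor_val a x)) /esym.
Qed.

Lemma phi_TSK i (j : 'I_(k i)) x :
  cuntz_tensor_val (phi (alg_T j)) (cuntz_tensor_val (phi (alg_S j)) x) = x.
Proof. by rewrite phi_TS eqxx. Qed.

Lemma phi_S_monomial i (j : 'I_(k i)) r : exists r' d,
  d != 0 /\ cuntz_tensor_val (phi (alg_S j)) (delta r) = d *: delta r'.
Proof.
(* 1 + c = 'i and 1 - c / (1 + c) = -'i have modulus 1, and S T is the
   multiplication by an indicator function, so u and v are isometries *)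
pose c : R[i] := 'i%C - 1.
have c1E : 1 + c = 'i%C by rewrite /c addrC subrK.
have i0 : 'i%C != 0 :> R[i] by rewrite eq_complex /= oner_eq0 andbF.
have c0 : c != 0 by rewrite subr_eq0 eq_complex /= oner_eq0 andbF.
have c1 : 1 + c != 0 by rewrite c1E.
have c2 : 2 + c != 0.
  have -> : 2 + c = 1 + 'i%C by rewrite -c1E; ring.
  by rewrite eq_complex /= add0r oner_eq0 andbF.
have ni : normc ('i%C : R[i]) = 1 by rewrite /= expr0n /= add0r expr1n sqrtr1.
pose e := alg_S j * alg_T j.
pose u := 1 + c *: e; pose v := 1 + - (c / (1 + c)) *: e.
have SC := phi_contractive (pcomp_contractive _ : contractive (cuntz_tensor_val (alg_S j))).
have TC := phi_contractive (pcomp_contractive _ : contractive (cuntz_tensor_val (alg_T j))).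
have uE x : cuntz_tensor_val (phi u) x = x + c *:
    cuntz_tensor_val (phi (alg_S j)) (cuntz_tensor_val (phi (alg_T j)) x).
  by rewrite /u phiD phi1 phiZ phiM.
have vE x : cuntz_tensor_val (phi v) x = x - (c / (1 + c)) *:
    cuntz_tensor_val (phi (alg_S j)) (cuntz_tensor_val (phi (alg_T j)) x).
  by rewrite -scaleNr /v phiD phi1 phiZ phiM.
have uC : contractive (cuntz_tensor_val (phi u)).
  apply: phi_contractive; apply: (@tensor_ST_contractive R p p1 m k k0 i j c); last by [].
  by rewrite c1E.
have vC : contractive (cuntz_tensor_val (phi v)).
  apply: phi_contractive.
  apply: (@tensor_ST_contractive R p p1 m k k0 i j (- (c / (1 + c)))); last by [].
  have -> : 1 - c / (1 + c) = (1 + c)^-1 by field.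
  by rewrite c1E Normc.normcV ni invr1.
exact: (isometry_monomial p2 c0 c1 c2 (phi_TSK j) SC TC uE uC vE vC).
Qed.

Lemma phi_S_shift i (j : 'I_(k i)) : exists f : point -> point, exists d : point -> R[i],
  forall r, d r != 0 /\ cuntz_tensor_val (phi (alg_S j)) (delta r) = d r *: delta (f r).
Proof.
have [f fP] := choice (phi_S_monomial j); have [d dP] := choice fP.
by exists f, d.
Qed.

Definition shift_map i (j : 'I_(k i)) : point -> point :=
  projT1 (cid (phi_S_shift j)).

Lemma shift_mapP i (j : 'I_(k i)) r :
  exists2 d, d != 0 & cuntz_tensor_val (phi (alg_S j)) (delta r) = d *: delta (shift_map j r).
Proof.
by rewrite /shift_map; case: cid => f /= [d /(_ r) [d0 dE]]; exists (d r).
Qed.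

Lemma shift_map_inj i (j : 'I_(k i)) : injective (shift_map j).
Proof.
move=> r r' rr'; have [d d0 dE] := shift_mapP j r; have [d' d'0 dE'] := shift_mapP j r'.
have h : d^-1 *: delta r = d'^-1 *: delta r'.
  rewrite -[delta r](phi_TSK j) -[delta r'](phi_TSK j) dE dE' !bopZ rr'.
  by rewrite !scalerA !mulVf.
by apply: delta_scale_inj h; rewrite invr_eq0.
Qed.

(** The image of [T_j] annihilates the range of the image of [S_j'] and is injective on that of
    [S_j]. *)
Lemma shift_map_disjoint i (j j' : 'I_(k i)) r r' : j != j' ->
  shift_map j r <> shift_map j' r'.
Proof.
move=> jj' rr'; have [d d0 dE] := shift_mapP j r; have [d' d'0 dE'] := shift_mapP j' r'.
have := phi_TS j j (delta r); rewrite eqxx dE bopZ rr'.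
have := phi_TS j j' (delta r'); rewrite (negPf jj') dE' bopZ => /eqP.
rewrite scaler_eq0 (negPf d'0)/= => /eqP ->; rewrite scaler0 => /esym/eqP.
by rewrite (negPf (delta_neq0 _ _)).
Qed.

Lemma shift_map_comm i i' (j : 'I_(k i)) (j' : 'I_(k i')) r : i != i' ->
  shift_map j (shift_map j' r) = shift_map j' (shift_map j r).
Proof.
move=> ii'; have := congr1 (fun a => cuntz_tensor_val (phi a) (delta r)) (alg_SSC j j' ii').
rewrite !phiM => h.
have {h} : cuntz_tensor_val (phi (alg_S j)) (cuntz_tensor_val (phi (alg_S j')) (delta r)) =
  cuntz_tensor_val (phi (alg_S j')) (cuntz_tensor_val (phi (alg_S j)) (delta r)) by [].
have [d d0 ->] := shift_mapP j r; have [d' d'0 ->] := shift_mapP j' r.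
rewrite !bopZ.
have [e e0 ->] := shift_mapP j (shift_map j' r).
have [e' e'0 ->] := shift_mapP j' (shift_map j r).
by rewrite !scalerA => /delta_scale_inj; apply; rewrite mulf_neq0.
Qed.

Lemma shift_map_near i (j : 'I_(k i)) : exists L, forall r, coord_near l L r (shift_map j r).
Proof.
have l0 j' : (0 < l j')%N := ltnW (hl j').
have /set_mem/(cuntz_tensor_local l0) := cuntz_tensor_valP (phi (alg_S j)).
(* The threshold 1 suffices: [S_j] is sent to an isometry, so the nonzero entry in each column has
   modulus 1. *)
move=> /(_ 1 ltr01)[L LP]; exists L => r; apply: LP.
have [d d0 dE] := shift_mapP j r.
rewrite dE lp_valZ delta_id mulr1.
have si : isometric (cuntz_tensor_val (phi (alg_S j))).
  apply: (@left_inverse_isometric _ _ _ _ _ (cuntz_tensor_val (phi (alg_T j)))).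
  - by apply: phi_contractive; exact: pcomp_contractive.
  - by apply: phi_contractive; exact: pcomp_contractive.
  - exact: phi_TSK.
have := si (delta r); rewrite dE normrZ !lpnormE !lp_norm_delta mulr1.
by move=> /(congr1 (@complex.Re R)) /= ->.
Qed.

Lemma cuntz_tensor_dim : (m <= n)%N.
Proof.
have [L LP] := choice (fun i => shift_map_near (Ordinal (k0 i))).
(* [hk i] reads 1 < k i and thus yields the generator of index 1, [k0 i] that of index 0. *)
apply: (@commuting_embeddings_dim m n l (\max_i L i)%N
  (fun i => shift_map (Ordinal (k0 i))) (fun i => shift_map (Ordinal (hk i)))) => //.
- by move=> i; exact: shift_map_inj.
- by move=> i; exact: shift_map_inj.
- by move=> i x y; exact: shift_map_disjoint.
- by move=> i j x; exact: shift_map_comm.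
- by move=> i j x; exact: shift_map_comm.
- by move=> i x j; apply: tree_nearW (LP i x j); exact: leq_bigmax.
Qed.

End homomorphism.

Theorem theorem7p8 (R : realType) (p : R) (p1 : 1 <= p) (p2 : p != 2)
    (m n : nat) (m0 : (0 < m)%N) (n0 : (0 < n)%N)
    (k : 'I_m -> nat) (l : 'I_n -> nat)
    (hk : forall i, (2 <= k i)%N) (hl : forall j, (2 <= l j)%N) :
  (exists phi : {lrmorphism cuntz_tensor p1 k -> cuntz_tensor p1 l},
     forall a : cuntz_tensor p1 k,
       `|cuntz_tensor_val (phi a)| <= `|cuntz_tensor_val a|) ->
  (m <= n)%N.
Proof.
by move=> [phi phi_contr]; exact: (cuntz_tensor_dim p2 hk hl phi_contr).
Qed.
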